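(* Let $M$ be a flat bi-Lagrangian manifold. For a given field $(g,B)$ on $M$, there exists a unique double-metric connection $\nabla^1$ on $M$ that has vanishing mixed torsion and whose restrictions to $S_\pm$ are determined by the Levi-Civita connection of the metric $g$ of $L$, in the following sense: if $D^{+}$ and $D^{-}$ are the two $g$-preserving connections on $L$ corresponding to $\nabla^1$, then both partial connections $D^{\pm,L}_XY=D^\pm_XY$ ($X,Y\in\Gamma L$) along the foliation $L$ are equal to the Levi-Civita connection of $g$.
   Context: Flat bi-Lagrangian (flat para-Kähler) manifold: a $2m$-dimensional manifold $M$ with an atlas of distinguished local coordinates $(x^i,\tilde x_i)$, $i=1,\dots,m$, whose coordinate changes are locally $x^i=\alpha^i_jx'^j+\alpha^i_0$, $\tilde x_i=\beta_i^k\tilde x'_k+\beta_i^0$ with constants satisfying $\alpha^i_j\beta_i^k=\delta_j^k$. $L$ and $\tilde L$ are the subbundles of $TM$ spanned by the $\partial/\partial x^i$ and by the $\partial/\partial\tilde x_i$, so $TM=L\oplus\tilde L$. $\gamma$ is the neutral metric with $L,\tilde L$ isotropic and $\gamma(\partial/\partial x^i,\partial/\partial\tilde x_j)=\delta_i^j$. $L^*$ is identified with $\mathrm{ann}\,\tilde L\subset T^*M$, and $L\oplus L^*$ with $TM$ by $(X,\alpha)\mapsto X+\sharp_\gamma\alpha$. $\nabla^0$ is the flat connection with $\nabla^0(\partial/\partial x^i)=0=\nabla^0(\partial/\partial\tilde x_i)$. With $[\,,\,]$ the Lie bracket, $[\mathbf X,\mathbf Y]_{\nabla^0}=[\mathbf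 X,\mathbf Y]-\mathbf X\wedge_{\nabla^0}\mathbf Y$, where $\gamma(\mathbf Z,\mathbf X\wedge_{\nabla^0}\mathbf Y)=\frac12[\gamma(\mathbf X,\nabla^0_{\mathbf Z}\mathbf Y)-\gamma(\mathbf Y,\nabla^0_{\mathbf Z}\mathbf X)]$. A field $(g,B)$ consists of a non-degenerate metric $g$ on the bundle $L$ with inertia indices $p,q$, $p+q=m$, and $B\in\Gamma\wedge^2L^*$. Put $\iota_\pm X=(X,\flat_{B\pm g}X)$, where $\flat_{B\pm g}X=i(X)B\pm g(X,\cdot)$, and $S_\pm=\iota_\pm(L)$; then $TM=S_+\oplus S_-$, and the generalized metric is $\mathcal H((X,\alpha),(Y,\beta))=g(X,Y)+g^{-1}(\flat_BX-\alpha,\flat_BY-\beta)$. A double-metric connection is a connection $\nabla$ on $TM$ preserving both $\gamma$ and $\mathcal H$. These correspond bijectively to pairs $D^\pm$ of $g$-preserving connections on the bundle $L$ over $M$, via $\nabla_{\mathbf Z}(\iota_\pm X)=\iota_\pm(D^\pm_{\mathbf Z}X)$, $\mathbf Z\in TM$, $X\in\Gamma L$. The Gualtieri torsion of $\nabla$ is the totally skew-symmetric tensor $$\mathcal T^\nabla(\mathbf X,\mathbf Y,\mathbf Z)=\gamma(\nabla_{\mathbf X}\mathbf Y-\nabla_{\mathbf Y}\mathbf X-[\mathbf X,\mathbf Y]_{\nabla^0},\mathbf Z)+\tfrac12\{\gamma(\nabla_{\mathbf Z}\mathbf X,\mathbf Y)-\gamma(\nabla_{\mathbf Z}\mathbf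 Y,\mathbf X)\}.$$ Its mixed torsion consists of the components $\mathcal T^\nabla(\mathbf X_-,\mathbf Y_+,\mathbf Z_+)$ and $\mathcal T^\nabla(\mathbf X_+,\mathbf Y_-,\mathbf Z_-)$, with indices $\pm$ denoting arguments in $S_\pm$. The Levi-Civita connection of the metric $g$ of $L$ is the unique partial connection $D_XY$ ($X,Y\in\Gamma L$, sections differentiable on $M$) on $L$ along the foliation $L$ with $X(g(Y,Z))=g(D_XY,Z)+g(Y,D_XZ)$ and $D_XY-D_YX=[X,Y]$.
   Formalization: The formal theorem adds that flat_{B+g} and flat_{B-g} are isomorphisms L → L* at every point (automatic for definite g); without this uniqueness fails, e.g. for g = diag(1,-1), B = dx^1∧dx^2 on R^4. *)

(* Defs.v *)
From HB Require Import structures.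
From mathcomp Require Import all_boot all_order all_algebra.
From mathcomp Require Import all_classical all_reals all_analysis.

Set Implicit Arguments.
Unset Strict Implicit.
Unset Printing Implicit Defensive.

Import Order.TTheory GRing.Theory Num.Theory.
Import numFieldNormedType.Exports.

Local Open Scope classical_set_scope.
Local Open Scope ring_scope.

(* Vectors are rows and linear maps act on the right: v |-> v *m A. In 'rV_(m + m)
   the left half holds the L-coordinates (the x^i, resp. the coefficients of the
   d/dx^i) and the right half the Ltilde-coordinates. *)

Section Smooth.
Variables (R : realType) (n : nat).

Fixpoint Ck (k : nat) (U : set 'rV[R]_n) (f : 'rV[R]_n -> R) : Prop :=
  {in U, continuous f} /\
  if k is k'.+1 then
    forall i : 'I_n, {in U, forall v, derivable f v (delta_mx 0 i)} /\
                     Ck k' U (fun v => 'D_(delta_mx 0 i) f v)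
  else True.

Definition Cinfty (U : set 'rV[R]_n) (f : 'rV[R]_n -> R) : Prop :=
  forall k, Ck k U f.

End Smooth.

Record fblManifold (R : realType) (m : nat) := FblManifold {
  fbl_sort :> topologicalType;
  fbl_hausdorff : hausdorff_space fbl_sort;
  fbl_second_countable : @second_countable fbl_sort;
  chart : Type;
  cdom : chart -> set fbl_sort;
  xcoord : chart -> fbl_sort -> 'rV[R]_(m + m);
  param : chart -> 'rV[R]_(m + m) -> fbl_sort;
  open_cdom : forall c, open (cdom c);
  open_image : forall c, open (xcoord c @` cdom c);
  xcoordK : forall c, {in cdom c, cancel (xcoord c) (param c)};
  xcoord_continuous : forall c, {in cdom c, continuous (xcoord c)};
  param_continuous : forall c, {in xcoord c @` cdom c, continuous (param c)};
  cdom_cover : forall x, exists c, cdom c x;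
  (* a j i = alpha^i_j and b k i = beta_i^k *)
  transition : forall c d x, cdom c x -> cdom d x ->
    exists (a b : 'M[R]_m) (a0 b0 : 'rV[R]_m),
      a *m b^T = 1%:M /\
      \forall y \near x,
        lsubmx (xcoord c y) = lsubmx (xcoord d y) *m a + a0 /\
        rsubmx (xcoord c y) = rsubmx (xcoord d y) *m b + b0
}.

Section Geometry.
Variables (R : realType) (m : nat) (M : fblManifold R m).

Local Notation V := 'rV[R]_(m + m).
Local Notation W := 'rV[R]_m.

(* T_xM is identified with V through the frame of an arbitrarily chosen chart
   chart_at x around x. A vector field is then a function M -> V; its components
   in the chart c are given by [vcomp c]. The decomposition TM = L (+) Ltilde and
   gamma have the same expression in all the charts, so that they can be
   expressed on V. *)
Definition chart_at (x : M) : chart M := sval (cid (cdom_cover x)).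

Definition smooth_in (c : chart M) (f : M -> R) : Prop :=
  Cinfty (xcoord c @` cdom c) (f \o param c).

Definition smooth (f : M -> R) : Prop := forall c, smooth_in c f.

(* Derivative at x, in the direction v of T_xM, of a function on M. *)
Definition dirD (T : normedModType R) (x : M) (v : V) (f : M -> T) : T :=
  'D_v (f \o param (chart_at x)) (xcoord (chart_at x) x).

(* In a chart, the components of X are the derivatives of the coordinates
   along X. *)
Definition vcomp (c : chart M) (X : M -> V) (x : M) : V := dirD x (X x) (xcoord c).

(* The tangent vector at x whose components in the chart c are v. *)
Definition tvec (c : chart M) (x : M) (v : V) : V :=
  'D_v (xcoord (chart_at x) \o param c) (xcoord c x).

Definition smoothT (X : M -> V) : Prop :=
  forall c (i : 'I_(m + m)), smooth_in c (fun x => vcomp c X x 0 i).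

(* A section of L is a function M -> W, and so is a section of L^*: alpha stands
   for the sum of the alpha_i dx^i. Since gamma(d/dx^i, d/dxtilde_j) = delta_i^j,
   sharp_gamma dx^i = d/dxtilde_i, whence [row_mx X alpha] is the image in TM of
   the element (X, alpha) of L (+) L^*. *)
Definition inL (X : M -> W) (x : M) : V := row_mx (X x) 0.

Definition smoothL (X : M -> W) : Prop := smoothT (inL X).

(* Smoothness of the tensor (X, Y) |-> X *m h *m Y^T on L: its components in the
   local coframes dx^i are smooth. *)
Definition basisL (c : chart M) (i : 'I_m) (x : M) : W :=
  lsubmx (tvec c x (row_mx (delta_mx 0 i) 0)).

Definition bilin (h : M -> 'M[R]_m) (x : M) (v w : W) : R :=
  (v *m h x *m w^T) 0 0.

Definition smoothLL (h : M -> 'M[R]_m) : Prop :=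
  forall c i j, smooth_in c (fun x => bilin h x (basisL c i x) (basisL c j x)).

Definition gamma (v w : V) : R :=
  (lsubmx v *m (rsubmx w)^T + rsubmx v *m (lsubmx w)^T) 0 0.

(* The vector w such that gamma z w = om z for all z, when om is linear. *)
Definition sharp_gamma (om : V -> R) : V :=
  row_mx (\row_i om (delta_mx 0 (rshift m i))) (\row_i om (delta_mx 0 (lshift m i))).

Lemma gamma_sharp (om : {linear V -> R^o}) (z : V) : gamma z (sharp_gamma om) = om z.
Proof.
rewrite /gamma /sharp_gamma row_mxKl row_mxKr mxE !mxE [in RHS](row_sum_delta z).
rewrite linear_sum big_split_ord /=; congr (_ + _).
  by apply: eq_bigr => i _; rewrite linearZ !mxE.
by apply: eq_bigr => i _; rewrite linearZ !mxE.
Qed.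

Definition nabla0 (x : M) (v : V) (Y : M -> V) : V := dirD x v (vcomp (chart_at x) Y).

Definition lie_bracket (X Y : M -> V) (x : M) : V :=
  dirD x (X x) (vcomp (chart_at x) Y) - dirD x (Y x) (vcomp (chart_at x) X).

Definition wedge0 (X Y : M -> V) (x : M) : V :=
  sharp_gamma (fun z =>
    2^-1 * (gamma (X x) (nabla0 x z Y) - gamma (Y x) (nabla0 x z X))).

Definition bracket0 (X Y : M -> V) (x : M) : V := lie_bracket X Y x - wedge0 X Y x.

(* Covariant derivatives D : Gamma A -> Gamma E -> Gamma E, where GA and GE are
   the differentiable sections and [a] is the inclusion of A in TM (A is TM, or L
   for partial connections). The values of D outside of GA, GE are irrelevant. *)
Definition is_connection (A E : lmodType R) (a : (M -> A) -> M -> V)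
    (GA : (M -> A) -> Prop) (GE : (M -> E) -> Prop)
    (D : (M -> A) -> (M -> E) -> M -> E) : Prop :=
  [/\ forall Z X, GA Z -> GE X -> GE (D Z X),
      forall f Z Z' X, smooth f -> GA Z -> GA Z' -> GE X -> forall x,
        D (fun y => f y *: Z y + Z' y) X x = f x *: D Z X x + D Z' X x,
      forall Z X X', GA Z -> GE X -> GE X' -> forall x,
        D Z (fun y => X y + X' y) x = D Z X x + D Z X' x
    & forall f Z X, smooth f -> GA Z -> GE X -> forall x,
        D Z (fun y => f y *: X y) x =
        dirD x (a Z x) (f : M -> R^o) *: X x + f x *: D Z X x].

Definition preserves (A E : lmodType R) (a : (M -> A) -> M -> V)
    (GA : (M -> A) -> Prop) (GE : (M -> E) -> Prop)
    (h : M -> E -> E -> R) (D : (M -> A) -> (M -> E) -> M -> E) : Prop :=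
  forall Z X Y, GA Z -> GE X -> GE Y -> forall x,
    dirD x (a Z x) ((fun y => h y (X y) (Y y)) : M -> R^o) =
    h x (D Z X x) (Y x) + h x (X x) (D Z Y x).

Record gBfield (p q : nat) := GBField {
  gf : M -> 'M[R]_m;
  Bf : M -> 'M[R]_m;
  gf_sym : forall x, (gf x)^T = gf x;
  gf_index_sum : (p + q = m)%N;
  gf_index : forall x, exists2 P : 'M[R]_m, P \in unitmx &
    P *m gf x *m P^T = diag_mx (\row_(i < m) if (i < p)%N then 1 else -1);
  gf_smooth : smoothLL gf;
  Bf_skew : forall x, (Bf x)^T = - Bf x;
  Bf_smooth : smoothLL Bf
}.

Section Field.
Variables (p q : nat) (F : gBfield p q).

(* flat_h X = h(X, .) is X *m h. *)
Definition iota_plus (X : M -> W) (x : M) : V :=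
  row_mx (X x) (X x *m (Bf F x + gf F x)).

Definition iota_minus (X : M -> W) (x : M) : V :=
  row_mx (X x) (X x *m (Bf F x - gf F x)).

Definition genmetric (x : M) (v w : V) : R :=
  bilin (gf F) x (lsubmx v) (lsubmx w) +
  bilin (fun y => invmx (gf F y)) x
    (lsubmx v *m Bf F x - rsubmx v) (lsubmx w *m Bf F x - rsubmx w).

Definition double_metric_connection (nabla : (M -> V) -> (M -> V) -> M -> V) : Prop :=
  [/\ is_connection id smoothT smoothT nabla,
      preserves id smoothT smoothT (fun _ => gamma) nabla
    & preserves id smoothT smoothT genmetric nabla].

Definition gualtieri_torsion (nabla : (M -> V) -> (M -> V) -> M -> V)
    (X Y Z : M -> V) (x : M) : R :=
  gamma (nabla X Y x - nabla Y X x - bracket0 X Y x) (Z x) +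
  2^-1 * (gamma (nabla Z X x) (Y x) - gamma (nabla Z Y x) (X x)).

Definition vanishing_mixed_torsion (nabla : (M -> V) -> (M -> V) -> M -> V) : Prop :=
  forall X Y Z, smoothL X -> smoothL Y -> smoothL Z -> forall x,
    gualtieri_torsion nabla (iota_minus X) (iota_plus Y) (iota_plus Z) x = 0 /\
    gualtieri_torsion nabla (iota_plus X) (iota_minus Y) (iota_minus Z) x = 0.

Definition g_connection (D : (M -> V) -> (M -> W) -> M -> W) : Prop :=
  is_connection id smoothT smoothL D /\
  preserves id smoothT smoothL (bilin (gf F)) D.

Definition corresponding_pair (nabla : (M -> V) -> (M -> V) -> M -> V)
    (Dp Dm : (M -> V) -> (M -> W) -> M -> W) : Prop :=
  [/\ g_connection Dp, g_connection Dm
    & forall Z X, smoothT Z -> smoothL X -> forall x,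
        nabla Z (iota_plus X) x = iota_plus (Dp Z X) x /\
        nabla Z (iota_minus X) x = iota_minus (Dm Z X) x].

Definition levi_civita (D : (M -> W) -> (M -> W) -> M -> W) : Prop :=
  [/\ is_connection inL smoothL smoothL D,
      preserves inL smoothL smoothL (bilin (gf F)) D
    & forall X Y, smoothL X -> smoothL Y -> forall x,
        inL (D X Y) x - inL (D Y X) x = lie_bracket (inL X) (inL Y) x].

(* The partial connection D^L along the foliation L. *)
Definition restrL (D : (M -> V) -> (M -> W) -> M -> W)
    (X Y : M -> W) : M -> W := D (inL X) Y.

Definition restricts_to_levi_civita (nabla : (M -> V) -> (M -> V) -> M -> V) : Prop :=
  exists Dp Dm, [/\ corresponding_pair nabla Dp Dm,
    levi_civita (restrL Dp) & levi_civita (restrL Dm)].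

End Field.
End Geometry.

(* Main.v *)
Require Import Defs.
From HB Require Import structures.
From mathcomp Require Import all_boot all_order all_algebra.
From mathcomp Require Import all_classical all_reals all_analysis.
From mathcomp Require Import ring lra.
Set Implicit Arguments.
Unset Strict Implicit.
Unset Printing Implicit Defensive.
Import Order.TTheory GRing.Theory Num.Theory.
Import numFieldNormedType.Exports.
Local Open Scope classical_set_scope.
Local Open Scope ring_scope.

(** Put P = B + g and Q = B - g, so that S_+ and S_- are the graphs of P and Q,
    P^T = - Q and P - Q = 2 g. A double-metric connection nabla amounts to two
    g-preserving connections D^+ and D^- on L.

    Uniqueness. As S_+ and S_- are orthogonal for gamma and nabla preserves both, the mixed
    torsion T(X_-, Y_+, Z_+) collapses to gamma(nabla_{X_-} Y_+ - [X_-, Y_+]_0, Z_+)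
    ([mixed_torsionE]); its vanishing prescribes D^+ along S_-, and in the same way D^-
    along S_+. The last condition prescribes D^+ and D^- along L. Since B - g and B + g are
    invertible, TM = L (+) S_- = L (+) S_+, hence nothing is left to choose
    ([pair_unique], [nabla1_unique]). Identities of the form g(A, Z) = g(A', Z) are only
    available for globally defined smooth sections Z; bump functions provide enough of
    them ([exists_section]).

    Existence. In flat coordinates both prescriptions are a directional derivative plus a
    term of order zero: the Christoffel term of the Levi-Civita connection on the
    L-component of the direction ([lc_form]), and on its S_- component the expression
    [mixed_form] obtained by expanding the metric bracket, in which the derivatives of X_-
    cancel. Their sum [christ_form] is skew up to the derivative of g
    ([christ_form_metric]) and does not depend on the chart ([christoffel_frame]), so that it
    defines a g-preserving connection [pair_conn] on L with the two prescribed
    restrictions ([pair_conn_torsion_free], [gamma_bracket_mixed]).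

    The construction is carried out for pairs (P, Q) with P^T = - Q and Q, P - Q invertible.
    It is applied to (B + g, B - g), which gives D^+, and to (B - g, B + g), which gives
    D^-; [comb_conn] glues the two along TM = S_+ (+) S_-.

    A tangent vector at x is given by its components in the chart [chart_at x], which
    varies with x in no regular way. Smoothness is therefore always established in a fixed
    chart c, after multiplication by the Jacobian [jac c x]; the quotient of the Jacobians
    for two charts is locally constant, because transitions are affine ([near_jac]). *)

(** * Linearity of directional derivatives *)

Section DirectionalDerivatives.
Variables (R : realType) (V : normedModType R).
Implicit Types (f : V -> R) (u v w x : V).

(** Reduces directional derivatives to one variable, where the mean value theorem and the
    chain rule apply. *)
Lemma derive_line f x u (s : R) :
  (derivable (fun r : R => f (r *: u + x) : R) s 1 <-> derivable f (s *: u + x) u) /\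
  'D_1 (fun r : R => f (r *: u + x) : R) s = 'D_u f (s *: u + x).
Proof.
rewrite /derivable /derive.
suff -> : (fun h : R => h^-1 *: ((f ((h *: 1 + s) *: u + x) : R) - f (s *: u + x))) =
   (fun h => h^-1 *: (f (h *: u + (s *: u + x)) - f (s *: u + x))) by [].
by apply/funext => h; rewrite scaler1 scalerDl addrA.
Qed.

Lemma is_derive_scale f x u (c L : R) :
  is_derive x u f L -> is_derive x (c *: u) f (c * L).
Proof.
move=> [df <-].
(* the function on the line is differentiable, hence has derivatives in all directions c *)
pose F := fun r : R => f (r *: u + x) : R.
have [dF DF] := derive_line f x u 0.
rewrite scale0r add0r in dF DF.
have /derivable1_diffP diffF : derivable F 0 1 by apply/dF.
have dFc : derivable F 0 c by apply: diff_derivable.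
have DFc : 'D_c F 0 = c * 'D_u f x.
  rewrite -DF -/F !deriveE // -[c in LHS]mulr1.
  by rewrite -[c * 1]/(c *: (1 : R)) linearZ.
have E : (fun h : R => h^-1 *: (F (h *: c + 0) - F 0)) =
         (fun h => h^-1 *: (f (h *: (c *: u) + x) - f x)).
  by apply/funext => h; rewrite /F addr0 scale0r add0r scalerA.
split; first by move: dFc; rewrite /derivable E.
by rewrite -DFc /derive E.
Qed.

(** Mean value theorem on the segment from x + h w to x + h w + h u: the increment in the
    direction u is h times a value of D_u f near x. This is the step by which continuous
    partial derivatives make the derivative linear in the direction. *)
Lemma is_derive_add_direction f x u w (L : R) :
  (\forall y \near x, derivable f y u) -> {for x, continuous ('D_u f)} ->
  is_derive x w f L -> is_derive x (w + u) f (L + 'D_u f x).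
Proof.
move=> du cu [dw <-].
suff H : (h^-1 *: (f (h *: (w + u) + x) - f x)) @[h --> 0^'] -->
      ('D_w f x + 'D_u f x : R^o).
  by split; [apply/cvg_ex; eexists; exact: H | apply/cvg_lim].
have E : (fun h : R => h^-1 *: (f (h *: (w + u) + x) - f x)) =
   (fun h => h^-1 *: (f (h *: w + x) - f x) +
     h^-1 *: (f (h *: u + (h *: w + x)) - f (h *: w + x)) : R^o).
  apply/funext => h; rewrite -[RHS]scalerDr [(f (h *: w + x) - f x) + _]addrC.
  by rewrite addrA subrK (addrA (h *: u)) -scalerDr [u + w]addrC.
rewrite E; apply: cvgD; first exact: dw.
apply/cvgrPdist_le => e e0.
have [d /= d0 dH] : exists2 d : R, 0 < d & forall y, `|x - y| < d ->
    derivable f y u /\ `|'D_u f x - 'D_u f y| <= e.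
  have : \forall y \near x, derivable f y u /\ `|'D_u f x - 'D_u f y| <= e.
    near=> y; split; near: y; first exact: du.
    by move/cvgrPdist_le : cu; exact.
  by move=> /nbhs_normP[d /= d0 dd]; exists d => // y; exact: dd.
(* the + 1 only makes the constant positive *)
pose C := `|w| + `|u| + 1.
have C0 : 0 < C by rewrite /C ltr_wpDl ?addr_ge0.
near=> h.
have h0 : h != 0 by near: h; exact: nbhs_dnbhs_neq.
have hd : `|h| * C < d.
  rewrite -ltr_pdivlMr //; near: h; apply: dnbhs0_lt; exact: divr_gt0.
have inball (s : R) : s \in `[0, 1] -> `|x - (s *: (h *: u) + (h *: w + x))| < d.
  rewrite in_itv /= => /andP[s0 s1].
  rewrite (addrA _ _ x) opprD addrCA subrr addr0 normrN.
  apply: le_lt_trans hd; rewrite (le_trans (ler_normD _ _)) // !normrZ.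
  rewrite (ger0_norm s0) /C !mulrDr mulr1 addrC -addrA lerD2l.
  by rewrite -[leLHS]addr0 lerD // ler_piMl // mulr_ge0.
have dg (s : R) : s \in `[0, 1] ->
   is_derive s 1 (fun r : R => f (r *: (h *: u) + (h *: w + x)) : R)
     (h * 'D_u f (s *: (h *: u) + (h *: w + x))).
  move=> /inball /dH[ds _].
  have [D1 D2] := derive_line f (h *: w + x) (h *: u) s.
  have [Ds1 Ds2] := is_derive_scale h (DeriveDef ds erefl).
  by split; [exact/D1 | rewrite D2 Ds2].
have [c c01 Ec] := @MVT_segment R _ _ 0 1 ler01
  (fun s hs => dg s (subset_itv_oo_cc hs))
  (derivable_within_continuous (fun s hs => @ex_derive _ _ _ _ _ _ _ (dg s hs))).
move: Ec; rewrite subr0 mulr1 scale1r scale0r add0r => ->.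
rewrite -[_ *: _]/(_ * _) mulKf //.
by have [_] := dH _ (inball _ c01).
Unshelve. all: by end_near. Qed.

End DirectionalDerivatives.

Section TotalDerivative.
Variables (R : realType) (n : nat).
Implicit Types (f : 'rV[R]_n -> R) (x h : 'rV[R]_n).

Lemma is_derive_partials f x h :
  (forall i, \forall y \near x, derivable f y (delta_mx 0 i)) ->
  (forall i, {for x, continuous ('D_(delta_mx 0 i) f)}) ->
  is_derive x h f (\sum_i h 0 i * 'D_(delta_mx 0 i) f x).
Proof.
move=> df cf; rewrite [h in is_derive _ h](row_sum_delta h).
elim: (index_enum _) => [|i s IHs]; first by rewrite !big_nil; exact: is_derive0.
rewrite !big_cons [_ *: _ + _]addrC [_ * _ + _]addrC.
have dfi y : derivable f y (delta_mx 0 i) ->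
    is_derive y (h 0 i *: delta_mx 0 i) f (h 0 i * 'D_(delta_mx 0 i) f y).
  by move=> dy; apply: is_derive_scale.
have /dfi[_ <-] := nbhs_singleton (df i).
apply: is_derive_add_direction IHs; first by apply: filterS (df i) => y /dfi[].
have E : {near x, (fun y => h 0 i * 'D_(delta_mx 0 i) f y) =1
    'D_(h 0 i *: delta_mx 0 i) f}.
  by apply: filterS (df i) => y /dfi[_ <-].
have /dfi[_ Ex] := nbhs_singleton (df i).
suff : 'D_(h 0 i *: delta_mx 0 i) f y @[y --> x] --> h 0 i * 'D_(delta_mx 0 i) f x.
  by rewrite -Ex.
apply: (cvg_trans (near_eq_cvg E)).
apply: cvgM; [exact: cvg_cst | exact: cf].
Qed.

End TotalDerivative.

(** * Algebra of C^k functions *)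

Section CkCalculus.
Variables (R : realType) (n : nat) (U : set 'rV[R]_n).
Hypothesis openU : open U.
Implicit Types (f g : 'rV[R]_n -> R) (k : nat).

Lemma nbhs_in_open x : x \in U -> nbhs x U.
Proof. by move=> /set_mem xU; exact: open_nbhs_nbhs. Qed.

Lemma Ck_eq k f g : {in U, f =1 g} -> Ck k U f -> Ck k U g.
Proof.
have neq (f' g' : 'rV[R]_n -> R) x : {in U, f' =1 g'} -> x \in U -> {near x, f' =1 g'}.
  move=> fg xU; have := nbhs_in_open xU; apply: filterS => y yU.
  by apply: fg; exact: mem_set.
elim: k f g => [|k IH] f g fg [cf H]; split=> //.
- move=> x xU; rewrite /continuous_at -(fg _ xU).
  exact: cvg_trans (near_eq_cvg (neq _ _ x fg xU)) (cf x xU).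
- move=> x xU; rewrite /continuous_at -(fg _ xU).
  exact: cvg_trans (near_eq_cvg (neq _ _ x fg xU)) (cf x xU).
move=> i; have [d C] := H i; split.
  by move=> x xU; apply: near_eq_derivable (d x xU); exact: neq.
by apply: IH C => x xU; apply: near_eq_derive; exact: neq.
Qed.

Lemma CkS k f : Ck k.+1 U f -> Ck k U f.
Proof.
elim: k f => [|k IH] f [cf H]; split=> // i.
by have [d C] := H i; split=> //; exact: IH.
Qed.

(** [Ck] asks for regularity of the total function v |-> D_i f v, whose formula is known only
    on U; this form takes any function that agrees with it on U. *)
Lemma CkS_intro k f (df : 'I_n -> 'rV[R]_n -> R) :
  Ck k U f -> (forall i x, x \in U -> is_derive x (delta_mx 0 i) f (df i x)) ->
  (forall i, Ck k U (df i)) -> Ck k.+1 U f.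
Proof.
move=> Cf dfP Cdf; split; first by case: k Cf Cdf => [|k] [].
move=> i; split=> [x /(dfP i)|]; first by move=> [].
by apply: Ck_eq (Cdf i) => x /(dfP i)[_ ->].
Qed.

Lemma Ck_continuous k f : Ck k U f -> {in U, continuous f}.
Proof. by case: k => [|k] []. Qed.

Lemma Ck_derive k f i : Ck k.+1 U f -> Ck k U ('D_(delta_mx 0 i) f).
Proof. by case=> _ /(_ i)[]. Qed.

Lemma Ck_is_derive k f i x : Ck k.+1 U f -> x \in U ->
  is_derive x (delta_mx 0 i) f ('D_(delta_mx 0 i) f x).
Proof. by case=> _ /(_ i)[d _] xU; split=> //; exact: d. Qed.

Lemma Ck_is_derive_dir f x h : Ck 1 U f -> x \in U ->
  is_derive x h f (\sum_i h 0 i * 'D_(delta_mx 0 i) f x).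
Proof.
move=> Cf xU; apply: is_derive_partials => i.
  have := nbhs_in_open xU; apply: filterS => y /mem_set yU.
  by have [] := Ck_is_derive i Cf yU.
by apply: (Ck_continuous (Ck_derive i Cf)).
Qed.

Lemma Ck_cst k (a : R) : Ck k U (cst a).
Proof.
elim: k a => [|k IH] a; first by split=> // x _; exact: cst_continuous.
by apply: (CkS_intro (df := fun=> cst 0)) => // i x _; exact: is_derive_cst.
Qed.

Lemma Ck_coord k (j : 'I_n) : Ck k U (fun v => v 0 j).
Proof.
elim: k => [|k IH]; first by split=> // x _; exact: coord_continuous.
apply: (CkS_intro (df := fun i => cst ((delta_mx 0 i : 'rV[R]_n) 0 j))) => //; last first.
  by move=> i; exact: Ck_cst.
move=> i x _; have did : derivable (@id 'rV[R]_n) x (delta_mx 0 i) by [].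
split; first by apply: (iffLR (derivable_mxP _ _ _) did).
have := derive_mx did; rewrite derive_id => /matrixP/(_ 0 j).
by rewrite [RHS]mxE => <-.
Qed.

Lemma CkD k f g : Ck k U f -> Ck k U g -> Ck k U (fun x => f x + g x).
Proof.
elim: k f g => [|k IH] f g Cf Cg.
  by split=> // x xU; exact: (cvgD (Ck_continuous Cf xU) (Ck_continuous Cg xU)).
apply: (CkS_intro (df := fun i x => 'D_(delta_mx 0 i) f x + 'D_(delta_mx 0 i) g x)).
- by apply: IH; exact: CkS.
- move=> i x xU.
  have df := Ck_is_derive i Cf xU; have dg := Ck_is_derive i Cg xU.
  exact: is_deriveD.
- by move=> i; apply: IH; exact: Ck_derive.
Qed.

Lemma CkM k f g : Ck k U f -> Ck k U g -> Ck k U (fun x => f x * g x).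
Proof.
elim: k f g => [|k IH] f g Cf Cg.
  by split=> // x xU; exact: (cvgM (Ck_continuous Cf xU) (Ck_continuous Cg xU)).
apply: (CkS_intro (df := fun i x => f x * 'D_(delta_mx 0 i) g x + g x * 'D_(delta_mx 0 i) f x)).
- by apply: IH; exact: CkS.
- move=> i x xU.
  have df := Ck_is_derive i Cf xU; have dg := Ck_is_derive i Cg xU.
  exact: is_deriveM.
- by move=> i; apply: CkD; apply: IH; do ?[exact: CkS|exact: Ck_derive].
Qed.

Lemma CkV k f : {in U, forall x, f x != 0} -> Ck k U f -> Ck k U (fun x => (f x)^-1).
Proof.
move=> f0; elim: k => [|k IH] Cf.
  by split=> // x xU; exact: (cvgV (f0 x xU) (Ck_continuous Cf xU)).
apply: (CkS_intro (df := fun i x => (- 1) * ((f x)^-1 * (f x)^-1) * 'D_(delta_mx 0 i) f x)).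
- by apply: IH; exact: CkS.
- move=> i x xU; have [df _] := Ck_is_derive i Cf xU.
  split; first exact: derivableV (f0 _ xU) df.
  rewrite deriveV ?f0 // mulN1r -[RHS]/((_ : R) *: _); congr (- _ *: _).
  by rewrite -invfM expr2.
- move=> i; apply: CkM; last exact: Ck_derive.
  by apply: CkM; [exact: Ck_cst | apply: CkM; apply: IH; exact: CkS].
Qed.

End CkCalculus.

(** * The flat exponential function *)

Section FlatFunction.
Variable R : realType.
Implicit Types (p q : {poly R}) (t : R).

(** The functions p(1/t) exp(-1/t) for t > 0, extended by 0. The family is stable under
    differentiation, which is what makes the induction on the order work. *)
Definition flat_exp p t : R := if 0 < t then p.[t^-1] * expR (- t^-1) else 0.

Lemma flat_expD p q t : flat_exp (p + q) t = flat_exp p t + flat_exp q t.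
Proof. by rewrite /flat_exp; case: ifP => _; rewrite ?addr0// hornerD mulrDl. Qed.

Lemma flat_mulX p t : 0 < t -> flat_exp ('X * p) t = t^-1 * flat_exp p t.
Proof. by move=> t0; rewrite /flat_exp t0 hornerM hornerX mulrA. Qed.

Lemma flat_le0 p t : t <= 0 -> flat_exp p t = 0.
Proof. by rewrite /flat_exp leNgt => /negbTE ->. Qed.

(** With s = 1/t this is s^(k+1) <= (k+1)! exp s, one term of the exponential series. *)
Lemma flat_monomial_bound (c : R) k t : `|flat_exp (c *: 'X^k) t| <= `|c| * k.+1`!%:R * `|t|.
Proof.
have [t0|t0] := leP t 0; first by rewrite flat_le0 // normr0 !mulr_ge0.
rewrite /flat_exp t0 hornerZ hornerXn !normrM -!mulrA ler_wpM2l //.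
have s0 : 0 < t^-1 by rewrite invr_gt0.
rewrite !gtr0_norm ?expR_gt0 ?exprn_gt0 // expRN.
rewrite ler_pdivrMr ?expR_gt0 //.
have -> : t^-1 ^+ k = t^-1 ^+ k.+1 * t by rewrite exprSr mulfVK ?gt_eqF.
rewrite mulrAC ler_pM2r // mulrC -ler_pdivrMr ?ltr0n ?fact_gt0 //.
by apply: le_trans (expR_ge1Dxn k (ltW s0)); rewrite lerDr ler01.
Qed.

(** The power of X is carried along so that the induction on p can absorb its leading
    factor. *)
Lemma flat_linear_bound p : exists C : R, forall t, `|flat_exp p t| <= C * `|t|.
Proof.
suff H k : exists C : R, forall t, `|flat_exp (p * 'X^k) t| <= C * `|t|.
  by have [C HC] := H 0%N; exists C => t; rewrite -[p]mulr1 -(expr0 'X).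
elim/poly_ind: p k => [|p c IH] k.
  by exists 0 => t; rewrite mul0r /flat_exp horner0 !mul0r if_same normr0.
have [C HC] := IH k.+1; exists (C + `|c| * k.+1`!%:R) => t.
rewrite mulrDl -mulrA -exprS mul_polyC flat_expD mulrDl.
by rewrite (le_trans (ler_normD _ _)) // lerD // flat_monomial_bound.
Qed.

Lemma flat_cvg0 p : flat_exp p t @[t --> 0^'] --> 0.
Proof.
have [C HC] := flat_linear_bound p.
apply/cvgr0Pnorm_le => e e0; near=> t.
apply: le_trans (HC t) _; apply: (@le_trans _ _ ((`|C| + 1) * `|t|)).
  by rewrite ler_wpM2r // (le_trans (ler_norm C)) // lerDl.
have C0 : 0 < `|C| + 1 by rewrite ltr_wpDl.
rewrite mulrC -ler_pdivlMr // ltW //; near: t; apply: dnbhs0_lt.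
exact: divr_gt0.
Unshelve. all: by end_near. Qed.

(** Away from 0 this is the chain rule. At 0 the difference quotient of p is again a function
    of the family, for X p, and tends to 0. *)
Lemma is_derive_flat p t : is_derive t 1 (flat_exp p) (flat_exp ('X * ('X * (p - p^`()))) t).
Proof.
have [t0|t0|->] := ltgtP t 0.
- rewrite flat_le0 ?ltW //.
  apply: (near_eq_is_derive (f := cst 0)) => //.
  by near=> s; rewrite flat_le0 // ltW //; near: s; exact: lt_nbhsl.
- apply: (near_eq_is_derive (f := (fun s : R => p.[s^-1] * expR (- s^-1)))).
    by near=> s; rewrite /flat_exp ifT //; near: s; exact: lt_nbhsr.
  have tn0 : t != 0 by rewrite gt_eqF.
  have dV : is_derive t 1 (fun s : R => s^-1) (- t^-2).
    by apply: is_derive_eq (is_deriveV tn0 (is_derive_id t 1)) _; rewrite scaler1.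
  have dp := is_derive1_comp (is_derive_poly p t^-1) dV.
  have de := @is_derive1_comp _ expR (fun s => - s^-1) t _ _ (is_derive_expR (- t^-1)) (is_deriveN dV).
  apply: is_derive_eq (is_deriveM dp de) _.
  rewrite /flat_exp t0 !hornerE /GRing.scale /=.
  by rewrite -exprVn; ring.
- rewrite flat_le0 //.
  have E : (fun h : R => h^-1 *: (flat_exp p (h *: 1 + 0) - flat_exp p 0)) = flat_exp ('X * p).
    apply/funext => h; rewrite addr0 (@flat_le0 p 0) // subr0 -[h *: 1]/(h * 1) mulr1.
    have [h0|h0] := leP h 0; first by rewrite !flat_le0 // scaler0.
    by rewrite flat_mulX.
  have c := flat_cvg0 ('X * p).
  by split; [apply/cvg_ex; exists 0; rewrite /= E | apply/cvg_lim => //; rewrite E].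
Unshelve. all: by end_near. Qed.

End FlatFunction.

(** * Smooth functions on an open set *)

Section CinftyClosure.
Variables (R : realType) (n : nat).
Implicit Types (U : set 'rV[R]_n) (f g : 'rV[R]_n -> R) (k : nat).

Lemma Ck_local k U f :
  (forall x, x \in U -> exists2 U', nbhs x U' & Ck k U' f) -> Ck k U f.
Proof.
elim: k f => [|k IH] f H.
  split=> // x xU; have [U' /nbhs_singleton/mem_set xU' [c _]] := H x xU.
  exact: c.
split=> [x xU|i].
  have [U' /nbhs_singleton/mem_set xU' [c _]] := H x xU; exact: c.
split=> [x xU|].
  have [U' /nbhs_singleton/mem_set xU' [_ /(_ i)[d _]]] := H x xU; exact: d.
by apply: IH => x /H[U' xU' [_ /(_ i)[_ C]]]; exists U'.
Qed.

Lemma Ck_subset k U U' f : U' `<=` U -> Ck k U f -> Ck k U' f.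
Proof.
move=> sub; elim: k f => [|k IH] f [c H]; split=> //.
- by move=> x /set_mem/sub/mem_set xU; exact: c.
- by move=> x /set_mem/sub/mem_set xU; exact: c.
move=> i; have [d C] := H i; split; last exact: IH.
by move=> x /set_mem/sub/mem_set xU; exact: d.
Qed.

Variable U : set 'rV[R]_n.
Hypothesis openU : open U.

Lemma is_derive_comp_scalar (F F' : R -> R) f (x u : 'rV[R]_n) (a : R) :
  (forall t : R, is_derive t 1 F (F' t)) -> is_derive x u f a ->
  is_derive x u (F \o f) (F' (f x) * a).
Proof.
move=> dF df.
pose l := fun r : R => f (r *: u + x) : R.
have [d1 D1] := derive_line f x u 0.
rewrite scale0r add0r in d1 D1.
have dl : is_derive (0 : R) 1 l a.
  by case: df => df <-; split; [apply/d1 | exact: D1].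
have [d2 D2] := derive_line (F \o f) x u 0.
rewrite scale0r add0r in d2 D2.
have [d3 D3] := is_derive1_comp (dF (l 0)) dl.
rewrite /l scale0r add0r in D3.
by split; [apply/d2 | rewrite -D2].
Qed.

Lemma Ck_flat_comp k p f : Cinfty U f -> Ck k U (flat_exp p \o f).
Proof.
move=> Cf; elim: k p => [|k IH] p.
  split=> // x xU.
  have [/derivable1_diffP/differentiable_continuous c _] := is_derive_flat p (f x).
  apply: (continuous_comp _ c); exact: (Ck_continuous (Cf 0%N)).
apply: (CkS_intro openU (df := fun i x => flat_exp ('X * ('X * (p - p^`()))) (f x) *
   'D_(delta_mx 0 i) f x)).
- exact: IH.
- move=> i x xU; apply: is_derive_comp_scalar; first exact: is_derive_flat.
  exact: (Ck_is_derive _ (Cf 1%N)).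
- move=> i; apply: CkM => //; first exact: IH.
  exact: (Ck_derive _ (Cf k.+1)).
Qed.

Lemma Cinfty_eq f g : {in U, f =1 g} -> Cinfty U f -> Cinfty U g.
Proof. by move=> fg Cf k; apply: Ck_eq fg _. Qed.

Lemma Cinfty_cst (a : R) : Cinfty U (cst a).
Proof. by move=> k; exact: Ck_cst. Qed.

Lemma Cinfty_coord j : Cinfty U (fun v => v 0 j).
Proof. by move=> k; exact: Ck_coord. Qed.

Lemma CinftyD f g : Cinfty U f -> Cinfty U g -> Cinfty U (fun x => f x + g x).
Proof. by move=> Cf Cg k; apply: CkD. Qed.

Lemma CinftyM f g : Cinfty U f -> Cinfty U g -> Cinfty U (fun x => f x * g x).
Proof. by move=> Cf Cg k; apply: CkM. Qed.

Lemma CinftyV f : {in U, forall x, f x != 0} -> Cinfty U f ->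
  Cinfty U (fun x => (f x)^-1).
Proof. by move=> f0 Cf k; apply: CkV. Qed.

Lemma Cinfty_sum (I : Type) (r : seq I) (P : pred I) (F : I -> 'rV[R]_n -> R) :
  (forall i, Cinfty U (F i)) -> Cinfty U (fun x => \sum_(i <- r | P i) F i x).
Proof.
move=> CF; elim: r => [|i r IH].
  by apply: Cinfty_eq (Cinfty_cst 0) => x _; rewrite big_nil.
have [Pi|Pi] := boolP (P i).
  by apply: Cinfty_eq (CinftyD (CF i) IH) => x _; rewrite big_cons Pi.
by apply: Cinfty_eq IH => x _; rewrite big_cons (negPf Pi).
Qed.

Lemma Cinfty_prod (I : Type) (r : seq I) (P : pred I) (F : I -> 'rV[R]_n -> R) :
  (forall i, Cinfty U (F i)) -> Cinfty U (fun x => \prod_(i <- r | P i) F i x).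
Proof.
move=> CF; elim: r => [|i r IH].
  by apply: Cinfty_eq (Cinfty_cst 1) => x _; rewrite big_nil.
have [Pi|Pi] := boolP (P i).
  by apply: Cinfty_eq (CinftyM (CF i) IH) => x _; rewrite big_cons Pi.
by apply: Cinfty_eq IH => x _; rewrite big_cons (negPf Pi).
Qed.

Lemma Cinfty_derive f i : Cinfty U f -> Cinfty U ('D_(delta_mx 0 i) f).
Proof. by move=> Cf k; exact: (Ck_derive _ (Cf k.+1)). Qed.

Lemma Cinfty_is_derive f x h : Cinfty U f -> x \in U ->
  is_derive x h f (\sum_i h 0 i * 'D_(delta_mx 0 i) f x).
Proof. by move=> Cf xU; exact: (Ck_is_derive_dir openU _ (Cf 1%N)). Qed.

Lemma Cinfty_flat p f : Cinfty U f -> Cinfty U (flat_exp p \o f).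
Proof. by move=> Cf k; exact: Ck_flat_comp. Qed.

End CinftyClosure.

(** * Affine changes of charts *)

Section Charts.
Variables (R : realType) (m : nat) (M : fblManifold R m).
Local Notation V := 'rV[R]_(m + m).
Implicit Types (c d : chart M) (x y : M) (v : V).

Definition cimage c : set V := xcoord c @` cdom c.

Lemma open_cimage c : open (cimage c). Proof. exact: open_image. Qed.

Lemma paramK c x : cdom c x -> param c (xcoord c x) = x.
Proof. by move=> cx; apply: xcoordK; exact: mem_set. Qed.

Lemma xcoord_cimage c x : cdom c x -> xcoord c x \in cimage c.
Proof. by move=> cx; apply: mem_set; exists x. Qed.

Lemma nbhs_cdom c x : cdom c x -> nbhs x (cdom c).
Proof. by move=> cx; apply: open_nbhs_nbhs; split=> //; exact: open_cdom. Qed.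

Lemma param_cimage c v : v \in cimage c -> cdom c (param c v).
Proof. by move=> /set_mem[x cx <-]; rewrite paramK. Qed.

Lemma param_xcoord c v : v \in cimage c -> xcoord c (param c v) = v.
Proof. by move=> /set_mem[x cx <-]; rewrite paramK. Qed.

Lemma near_param c x (P : M -> Prop) : cdom c x ->
  (\forall y \near x, P y) -> \forall v \near xcoord c x, P (param c v).
Proof.
move=> cx; have := param_continuous (xcoord_cimage cx).
by rewrite /continuous_at paramK //; apply.
Qed.

Lemma chart_atP x : cdom (chart_at x) x.
Proof. exact: (svalP (cid (cdom_cover x))). Qed.

(** K is the linear part, acting on rows, of the change from d to c near x. *)
Definition affine_change c d (K : 'M[R]_(m + m)) x :=
  exists t, \forall y \near x, xcoord c y = xcoord d y *m K + t.

Lemma affine_change_transition c d x : cdom c x -> cdom d x ->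
  exists2 a, a \in unitmx & affine_change c d (block_mx a 0 0 (invmx a)^T) x.
Proof.
move=> cx dx; have [a [b [a0 [b0 [ab E]]]]] := transition cx dx.
have [ua ub] := mulmx1_unit ab.
have bE : (invmx a)^T = b by rewrite -[b]trmxK -(mulKmx ua b^T) ab mulmx1.
exists a => //; exists (row_mx a0 b0).
apply: filterS E => y [E1 E2]; rewrite -[LHS]hsubmxK E1 E2 bE.
by rewrite -{3}[xcoord d y]hsubmxK mul_row_block !mulmx0 addr0 add0r add_row_mx.
Qed.

Lemma affine_change_comp c d e K L x :
  affine_change c d K x -> affine_change d e L x -> affine_change c e (L *m K) x.
Proof.
move=> [t E] [s F]; exists (s *m K + t); near=> y.
rewrite (near E y) // (near F y) //.
by rewrite mulmxDl mulmxA addrA.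
Unshelve. all: by end_near. Qed.

Lemma affine_change_inv c d K x : K \in unitmx ->
  affine_change c d K x -> affine_change d c (invmx K) x.
Proof.
move=> uK [t E]; exists (- t *m invmx K); apply: filterS E => y ->.
by rewrite -mulmxDl addrK mulmxK.
Qed.

Lemma affine_change_near c d K x :
  affine_change c d K x -> \forall y \near x, affine_change c d K y.
Proof.
by move=> [t /near_join E]; apply: filterS E => y E; exists t.
Qed.

(** The coordinates being affinely related near x, the difference quotients of a function in
    the two charts are equal, and so are their limits. *)
Lemma chart_change (T : normedModType R) c d K x v (f : M -> T) :
  cdom c x -> cdom d x -> affine_change c d K x ->
  (derivable (f \o param d) (xcoord d x) v <->
   derivable (f \o param c) (xcoord c x) (v *m K)) /\
  'D_v (f \o param d) (xcoord d x) = 'D_(v *m K) (f \o param c) (xcoord c x).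
Proof.
move=> cx dx [t E].
pose g := fun w : V => f (param c (w *m K + t)).
have Ex := nbhs_singleton E.
have fg : {near xcoord d x, f \o param d =1 g}.
  near=> w; rewrite /g /=.
  have wI : w \in cimage d.
    by apply: mem_set; near: w; apply: nbhs_in_open (xcoord_cimage dx); exact: open_cimage.
  rewrite -{2}(param_xcoord wI) -(near (near_param dx E) w) // paramK //.
  by near: w; apply: near_param dx _; exact: nbhs_cdom.
have gf : {near xcoord d x, g =1 f \o param d} by apply: filterS fg.
have Q : (fun h : R => h^-1 *: (g (h *: v + xcoord d x) - g (xcoord d x))) =
  (fun h => h^-1 *: ((f \o param c) (h *: (v *m K) + xcoord c x)
                     - (f \o param c) (xcoord c x))).
  by apply/funext => h; rewrite /g /= Ex mulmxDl -scalemxAl addrA.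
have dE : derivable (f \o param d) (xcoord d x) v <-> derivable g (xcoord d x) v.
  by split; exact: near_eq_derivable.
split; first by apply: (iff_trans dE); rewrite /derivable Q.
by rewrite (near_eq_derive v fg) /derive Q.
Unshelve. all: by end_near. Qed.

Lemma derive_xcoord c d K x v : cdom c x -> cdom d x -> affine_change c d K x ->
  'D_v (xcoord c \o param d) (xcoord d x) = v *m K.
Proof.
move=> cx dx A; have [_ ->] := chart_change v (xcoord c) cx dx A.
rewrite -[RHS](derive_id (xcoord c x)); apply: near_eq_derive.
have := nbhs_in_open (open_cimage (c := c)) (xcoord_cimage cx); apply: filterS => w /mem_set.
exact: param_xcoord.
Qed.

(** Matrix of the change from the chart chosen at x to the chart c; it turns components in
    the reference frame of the tangent space at x into components in c. *)
Definition jac c x : 'M[R]_(m + m) := \matrix_i dirD x (delta_mx 0 i) (xcoord c).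

(** The block of the Jacobian acting on L; the block acting on the other subbundle is its
    contragredient. *)
Definition frame c x : 'M[R]_m := ulsubmx (jac c x).

Lemma jac_unique c K x : cdom c x -> affine_change c (chart_at x) K x -> jac c x = K.
Proof.
move=> cx A; apply/row_matrixP => i; rewrite rowK rowE.
by rewrite /dirD (derive_xcoord _ cx (chart_atP x) A).
Qed.

Lemma jacP c x : cdom c x -> [/\ frame c x \in unitmx,
  jac c x = block_mx (frame c x) 0 0 (invmx (frame c x))^T &
  affine_change c (chart_at x) (jac c x) x].
Proof.
move=> cx; have [a ua A] := affine_change_transition cx (chart_atP x).
have J := jac_unique cx A; have aE : frame c x = a by rewrite /frame J block_mxKul.
by rewrite aE J.
Qed.

Lemma unit_frame c x : cdom c x -> frame c x \in unitmx.
Proof. by case/jacP. Qed.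

Lemma jacE c x : cdom c x -> jac c x = block_mx (frame c x) 0 0 (invmx (frame c x))^T.
Proof. by case/jacP. Qed.

Lemma affine_jac c x : cdom c x -> affine_change c (chart_at x) (jac c x) x.
Proof. by case/jacP. Qed.

Lemma mul_jac c x v : cdom c x -> v *m jac c x =
  row_mx (lsubmx v *m frame c x) (rsubmx v *m (invmx (frame c x))^T).
Proof.
move=> cx; rewrite jacE // -{1}[v]hsubmxK mul_row_block !mulmx0.
by rewrite addr0 add0r.
Qed.

Lemma unit_jac c x : cdom c x -> jac c x \in unitmx.
Proof.
move=> cx; rewrite jacE // unitmxE det_ublock unitrM -!unitmxE unitmx_tr.
by rewrite unitmx_inv unit_frame.
Qed.

Lemma jac_chart_at x : jac (chart_at x) x = 1%:M.
Proof.
apply: jac_unique (chart_atP x) _; exists 0; near=> y.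
by rewrite mulmx1 addr0.
Unshelve. all: by end_near. Qed.

Lemma frame_chart_at x : frame (chart_at x) x = 1%:M.
Proof. by rewrite /frame jac_chart_at scalar_mx_block block_mxKul. Qed.

(** [jac c] itself need not be continuous, since [chart_at y] jumps with y; only its
    quotient by the Jacobian of another chart is locally constant. *)
Lemma near_jac c d K x : cdom c x -> cdom d x -> affine_change c d K x ->
  \forall y \near x, jac c y = jac d y *m K.
Proof.
move=> cx dx A; near=> y.
have cy : cdom c y by near: y; exact: nbhs_cdom.
have dy : cdom d y by near: y; exact: nbhs_cdom.
apply: jac_unique cy _; apply: affine_change_comp (affine_jac dy).
by near: y; exact: affine_change_near.
Unshelve. all: by end_near. Qed.

Lemma near_frame c d x : cdom c x -> cdom d x -> exists2 a, a \in unitmx &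
  \forall y \near x, frame c y = frame d y *m a.
Proof.
move=> cx dx; have [a ua A] := affine_change_transition cx dx.
exists a => //; near=> y.
have dy : cdom d y by near: y; exact: nbhs_cdom.
rewrite /frame (near (near_jac cx dx A) y) // (jacE dy) mulmx_block.
by rewrite !block_mxKul !mul0mx addr0.
Unshelve. all: by end_near. Qed.

Lemma near_frame_chart_at c x : cdom c x ->
  \forall y \near x, frame c y = frame (chart_at x) y *m frame c x.
Proof.
move=> cx; have [a _ E] := near_frame cx (chart_atP x).
by have := nbhs_singleton E; rewrite frame_chart_at mul1mx => ->.
Qed.

Lemma dirD_chart (T : normedModType R) c x v (f : M -> T) : cdom c x ->
  dirD x v f = 'D_(v *m jac c x) (f \o param c) (xcoord c x).
Proof.
by move=> cx; have [_] := chart_change v f cx (chart_atP x) (affine_jac cx).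
Qed.

Lemma vcompE c X x : cdom c x -> vcomp c X x = X x *m jac c x.
Proof.
by move=> cx; rewrite /vcomp /dirD (derive_xcoord _ cx (chart_atP x) (affine_jac cx)).
Qed.

Lemma tvecE c x v : cdom c x -> tvec c x v = v *m invmx (jac c x).
Proof.
move=> cx; rewrite /tvec (derive_xcoord (K := invmx (jac c x)) _ (chart_atP x) cx) //.
by apply: affine_change_inv (affine_jac cx); exact: unit_jac.
Qed.

Lemma invmx_jac c x : cdom c x ->
  invmx (jac c x) = block_mx (invmx (frame c x)) 0 0 (frame c x)^T.
Proof.
move=> cx; have uA := unit_frame cx; apply: (can_inj (mulKmx (unit_jac cx))).
rewrite mulmxV ?unit_jac // jacE // mulmx_block !mulmx0 !mul0mx !addr0 !add0r.
by rewrite mulmxV // -trmx_mul mulmxV // trmx1 scalar_mx_block.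
Qed.

Lemma basisLE c i x : cdom c x -> basisL c i x = delta_mx 0 i *m invmx (frame c x).
Proof.
move=> cx; rewrite /basisL tvecE // invmx_jac // mul_row_block.
by rewrite row_mxKl mul0mx addr0.
Qed.

End Charts.

(** * Smooth matrix-valued functions in a chart *)

Section SmoothFunctions.
Variables (R : realType) (m : nat) (M : fblManifold R m).
Local Notation V := 'rV[R]_(m + m).
Local Notation W := 'rV[R]_m.
Variable c : chart M.
Implicit Types (x y : M) (v : V) (f g : M -> R).

Lemma smooth_in_eq f g : (forall x, cdom c x -> f x = g x) ->
  smooth_in c f -> smooth_in c g.
Proof.
move=> fg; apply: Cinfty_eq => [|v /param_cimage cv]; first exact: open_cimage.
exact: fg.
Qed.

Lemma smooth_in_cst (a : R) : smooth_in c (cst a).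
Proof. exact/Cinfty_cst/open_cimage. Qed.

Lemma smooth_inD f g : smooth_in c f -> smooth_in c g -> smooth_in c (fun x => f x + g x).
Proof. exact/CinftyD/open_cimage. Qed.

Lemma smooth_inM f g : smooth_in c f -> smooth_in c g -> smooth_in c (fun x => f x * g x).
Proof. exact/CinftyM/open_cimage. Qed.

Lemma smooth_inV f : (forall x, cdom c x -> f x != 0) -> smooth_in c f ->
  smooth_in c (fun x => (f x)^-1).
Proof.
by move=> f0; apply: CinftyV => [|v /param_cimage/f0 //]; exact: open_cimage.
Qed.

Lemma smooth_in_sum (I : Type) (r : seq I) (P : pred I) (F : I -> M -> R) :
  (forall i, smooth_in c (F i)) -> smooth_in c (fun x => \sum_(i <- r | P i) F i x).
Proof. by move=> CF; apply: Cinfty_sum => //; exact: open_cimage. Qed.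

Lemma smooth_in_prod (I : Type) (r : seq I) (P : pred I) (F : I -> M -> R) :
  (forall i, smooth_in c (F i)) -> smooth_in c (fun x => \prod_(i <- r | P i) F i x).
Proof. by move=> CF; apply: Cinfty_prod => //; exact: open_cimage. Qed.

Definition smooth_mx k l (F : M -> 'M[R]_(k, l)) : Prop :=
  forall i j, smooth_in c (fun x => F x i j).

Lemma smooth_mx_eq k l (F G : M -> 'M[R]_(k, l)) :
  (forall x, cdom c x -> F x = G x) -> smooth_mx F -> smooth_mx G.
Proof. by move=> FG CF i j; apply: smooth_in_eq (CF i j) => x /FG ->. Qed.

Lemma smooth_mx_cst k l (A : 'M[R]_(k, l)) : smooth_mx (fun=> A).
Proof. by move=> i j; exact: smooth_in_cst. Qed.

Lemma smooth_mxD k l (F G : M -> 'M[R]_(k, l)) :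
  smooth_mx F -> smooth_mx G -> smooth_mx (fun x => F x + G x).
Proof.
by move=> CF CG i j; apply: smooth_in_eq (smooth_inD (CF i j) (CG i j)) => x _; rewrite mxE.
Qed.

Lemma smooth_mxZ k l f (F : M -> 'M[R]_(k, l)) :
  smooth_in c f -> smooth_mx F -> smooth_mx (fun x => f x *: F x).
Proof.
by move=> Cf CF i j; apply: smooth_in_eq (smooth_inM Cf (CF i j)) => x _; rewrite mxE.
Qed.

Lemma smooth_mxN k l (F : M -> 'M[R]_(k, l)) : smooth_mx F -> smooth_mx (fun x => - F x).
Proof.
move=> CF; apply: smooth_mx_eq (smooth_mxZ (smooth_in_cst (- 1)) CF) => x _.
by rewrite scaleN1r.
Qed.

Lemma smooth_mxB k l (F G : M -> 'M[R]_(k, l)) :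
  smooth_mx F -> smooth_mx G -> smooth_mx (fun x => F x - G x).
Proof. by move=> CF CG; apply: smooth_mxD => //; exact: smooth_mxN. Qed.

Lemma smooth_mxM k l p (F : M -> 'M[R]_(k, l)) (G : M -> 'M[R]_(l, p)) :
  smooth_mx F -> smooth_mx G -> smooth_mx (fun x => F x *m G x).
Proof.
move=> CF CG i j; apply: (@smooth_in_eq (fun x => \sum_a F x i a * G x a j)).
  by move=> x _; rewrite mxE.
by apply: smooth_in_sum => a; exact: smooth_inM.
Qed.

Lemma smooth_mxT k l (F : M -> 'M[R]_(k, l)) : smooth_mx F -> smooth_mx (fun x => (F x)^T).
Proof. by move=> CF i j; apply: smooth_in_eq (CF j i) => x _; rewrite mxE. Qed.

Lemma smooth_lsubmx k l p (F : M -> 'M[R]_(k, l + p)) :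
  smooth_mx F -> smooth_mx (fun x => lsubmx (F x)).
Proof. by move=> CF i j; apply: smooth_in_eq (CF i (lshift p j)) => x _; rewrite mxE. Qed.

Lemma smooth_rsubmx k l p (F : M -> 'M[R]_(k, l + p)) :
  smooth_mx F -> smooth_mx (fun x => rsubmx (F x)).
Proof. by move=> CF i j; apply: smooth_in_eq (CF i (rshift l j)) => x _; rewrite mxE. Qed.

Lemma smooth_row_mx k l p (F : M -> 'M[R]_(k, l)) (G : M -> 'M[R]_(k, p)) :
  smooth_mx F -> smooth_mx G -> smooth_mx (fun x => row_mx (F x) (G x)).
Proof.
move=> CF CG i j; case: (splitP j) => a ja.
  by apply: smooth_in_eq (CF i a) => x _; rewrite (_ : j = lshift p a) ?row_mxEl //; exact: val_inj.
by apply: smooth_in_eq (CG i a) => x _; rewrite (_ : j = rshift l a) ?row_mxEr //; exact: val_inj.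
Qed.

Lemma smooth_row k (F : 'I_k -> M -> R) :
  (forall i, smooth_in c (F i)) -> smooth_mx (fun x => \row_i F i x).
Proof. by move=> CF i j; apply: smooth_in_eq (CF j) => x _; rewrite mxE. Qed.

Lemma smooth_det k (F : M -> 'M[R]_k) : smooth_mx F -> smooth_in c (fun x => \det (F x)).
Proof.
move=> CF; apply: smooth_in_sum => s; apply: smooth_inM; first exact: smooth_in_cst.
by apply: smooth_in_prod => i.
Qed.

Lemma smooth_adj k (F : M -> 'M[R]_k) : smooth_mx F -> smooth_mx (fun x => \adj (F x)).
Proof.
move=> CF i j; apply: (@smooth_in_eq (fun x => (-1) ^+ (j + i) * \det (row' j (col' i (F x))))).
  by move=> x _; rewrite mxE.
apply: smooth_inM; first exact: smooth_in_cst.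
apply: smooth_det => a b; apply: smooth_in_eq (CF (lift j a) (lift i b)) => x _.
by rewrite !mxE.
Qed.

(** Cramer's formula. *)
Lemma smooth_invmx k (F : M -> 'M[R]_k) : (forall x, cdom c x -> F x \in unitmx) ->
  smooth_mx F -> smooth_mx (fun x => invmx (F x)).
Proof.
move=> uF CF; apply: (@smooth_mx_eq _ _ (fun x => (\det (F x))^-1 *: \adj (F x))).
  by move=> x /uF ux; rewrite /invmx ux.
apply: smooth_mxZ (smooth_adj CF); apply: smooth_inV (smooth_det CF) => x /uF.
by rewrite unitmxE unitfE.
Qed.

End SmoothFunctions.

(** * Differentiation on the manifold *)

Section DirectionalDerivativesOnManifold.
Variables (R : realType) (m : nat) (M : fblManifold R m).
Local Notation V := 'rV[R]_(m + m).
Local Notation W := 'rV[R]_m.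
Implicit Types (c : chart M) (x y : M) (v : V) (f g : M -> R).

Definition dirD_exists (T : normedModType R) x v (F : M -> T) : Prop :=
  derivable (F \o param (chart_at x)) (xcoord (chart_at x) x) v.

Lemma near_dirD (T : normedModType R) x v (F G : M -> T) :
  (\forall y \near x, F y = G y) -> dirD x v F = dirD x v G.
Proof. by move=> /(near_param (chart_atP x)); exact: near_eq_derive. Qed.

Lemma near_dirD_exists (T : normedModType R) x v (F G : M -> T) :
  (\forall y \near x, F y = G y) -> dirD_exists x v F -> dirD_exists x v G.
Proof. by move=> /(near_param (chart_atP x)); exact: near_eq_derivable. Qed.

(** Smooth functions have derivatives linear in the direction, with the coefficients read
    in any chart around the point. *)
Lemma smooth_in_dirDE c f x v : smooth_in c f -> cdom c x ->
  dirD_exists x v (f : M -> R^o) /\ dirD x v (f : M -> R^o) =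
  \sum_i (v *m jac c x) 0 i * 'D_(delta_mx 0 i) (f \o param c) (xcoord c x).
Proof.
move=> Cf cx; have [E _] := chart_change v (f : M -> R^o) cx (chart_atP x) (affine_jac cx).
have [d D] := Cinfty_is_derive (open_cimage (c := c)) (v *m jac c x) Cf (xcoord_cimage cx).
by split; [apply/E | rewrite (dirD_chart _ _ cx)].
Qed.

Lemma dirD_exists_mx c k l (F : M -> 'M[R]_(k, l)) x v : smooth_mx c F -> cdom c x ->
  dirD_exists x v F.
Proof.
move=> CF cx; apply/derivable_mxP => i j.
by have [] := smooth_in_dirDE v (CF i j) cx.
Qed.

Lemma dirD_mxE k l (F : M -> 'M[R]_(k, l)) x v i j : dirD_exists x v F ->
  dirD x v F i j = dirD x v ((fun y => F y i j) : M -> R^o).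
Proof. by move=> dF; rewrite {1}/dirD derive_mx // mxE. Qed.

Lemma dirD_linear c k l (F : M -> 'M[R]_(k, l)) x (a : R) v w :
  smooth_mx c F -> cdom c x -> dirD x (a *: v + w) F = a *: dirD x v F + dirD x w F.
Proof.
move=> CF cx; apply/matrixP => i j.
rewrite !mxE !dirD_mxE; do ?exact: dirD_exists_mx CF cx.
rewrite !(proj2 (smooth_in_dirDE _ (CF i j) cx)) mulr_sumr -big_split /=.
by apply: eq_bigr => b _; rewrite mulmxDl -scalemxAl !mxE mulrDl mulrA.
Qed.

Lemma dirDD (T : normedModType R) (F G : M -> T) x v :
  dirD_exists x v F -> dirD_exists x v G ->
  dirD x v (fun y => F y + G y) = dirD x v F + dirD x v G.
Proof. exact: deriveD. Qed.

Lemma dirDN (T : normedModType R) (F : M -> T) x v :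
  dirD_exists x v F -> dirD x v (fun y => - F y) = - dirD x v F.
Proof. exact: deriveN. Qed.

Lemma dirDB (T : normedModType R) (F G : M -> T) x v :
  dirD_exists x v F -> dirD_exists x v G ->
  dirD x v (fun y => F y - G y) = dirD x v F - dirD x v G.
Proof. exact: deriveB. Qed.

Lemma dirD_cst (T : normedModType R) (a : T) x v : dirD x v (fun=> a) = 0.
Proof. exact: derive_cst. Qed.

Lemma dirDM (f g : M -> R^o) x v : dirD_exists x v f -> dirD_exists x v g ->
  dirD x v ((fun y => f y * g y) : M -> R^o) = dirD x v f * g x + f x * dirD x v g.
Proof.
move=> df dg; rewrite /dirD (deriveM df dg) addrC /= paramK; last exact: chart_atP.
by rewrite -![_ *: _]/(_ * _) (mulrC (g x)).
Qed.

Lemma dirD_existsM (f g : M -> R^o) x v : dirD_exists x v f -> dirD_exists x v g ->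
  dirD_exists x v ((fun y => f y * g y) : M -> R^o).
Proof. exact: derivableM. Qed.

Lemma dirD_exists_mulmx k l p (F : M -> 'M[R]_(k, l)) (G : M -> 'M[R]_(l, p)) x v :
  dirD_exists x v F -> dirD_exists x v G -> dirD_exists x v (fun y => F y *m G y).
Proof.
move=> /derivable_mxP dF /derivable_mxP dG; apply/derivable_mxP => i j.
have -> : (fun t => ((fun y => F y *m G y) \o param (chart_at x)) t i j) =
   \sum_a (fun t => F (param (chart_at x) t) i a * G (param (chart_at x) t) a j).
  by apply/funext => t; rewrite /= mxE fct_sumE.
by apply: derivable_sum => a; apply: derivableM; [exact: dF | exact: dG].
Qed.

Lemma dirD_mulmx k l p (F : M -> 'M[R]_(k, l)) (G : M -> 'M[R]_(l, p)) x v :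
  dirD_exists x v F -> dirD_exists x v G ->
  dirD x v (fun y => F y *m G y) = dirD x v F *m G x + F x *m dirD x v G.
Proof.
move=> dF dG; apply/matrixP => i j; rewrite dirD_mxE; last exact: dirD_exists_mulmx.
have dF' a b : dirD_exists x v (fun y => F y a b : R^o) by exact: (iffLR (derivable_mxP _ _ _) dF a b).
have dG' a b : dirD_exists x v (fun y => G y a b : R^o) by exact: (iffLR (derivable_mxP _ _ _) dG a b).
have -> : (fun y => (F y *m G y) i j : R^o) = \sum_a (fun y => F y i a * G y a j).
  by apply/funext => y; rewrite mxE fct_sumE.
rewrite /dirD.
have -> : (\sum_a (fun y => F y i a * G y a j : R^o)) \o param (chart_at x) =
  \sum_a ((fun y => F y i a * G y a j : R^o) \o param (chart_at x)).
  by apply/funext => y; rewrite /= !fct_sumE.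
rewrite derive_sum => [|a]; last exact: dirD_existsM.
rewrite !mxE -big_split /=; apply: eq_bigr => a _.
by rewrite [LHS](dirDM (dF' i a) (dG' a j)) !dirD_mxE.
Qed.

Lemma dirD_trmx k l (F : M -> 'M[R]_(k, l)) x v : dirD_exists x v F ->
  dirD x v (fun y => (F y)^T) = (dirD x v F)^T.
Proof.
move=> dF; apply/matrixP => i j; rewrite mxE !dirD_mxE //; last first.
  apply/derivable_mxP => a b; move/derivable_mxP : dF => /(_ b a).
  by apply: near_eq_derivable; near=> t; rewrite /= mxE.
by congr dirD; apply/funext => y; rewrite mxE.
Unshelve. all: by end_near. Qed.

Lemma dirDZ k l (f : M -> R^o) (F : M -> 'M[R]_(k, l)) x v :
  dirD_exists x v f -> dirD_exists x v F ->
  dirD x v (fun y => f y *: F y) = dirD x v f *: F x + f x *: dirD x v F.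
Proof.
move=> df dF; apply/matrixP => i j.
have dF' a b : dirD_exists x v (fun y => F y a b : R^o) by exact: (iffLR (derivable_mxP _ _ _) dF a b).
have E a b : (fun y => (f y *: F y) a b : R^o) = (fun y => f y * F y a b : R^o).
  by apply/funext => y; rewrite mxE.
rewrite dirD_mxE; last first.
  apply/derivable_mxP => a b; apply: near_eq_derivable (dirD_existsM df (dF' a b)).
  by near=> t; rewrite /= mxE.
by rewrite E dirDM // -dirD_mxE // !mxE.
Unshelve. all: by end_near. Qed.

(** In the chart c the derivative is the sum of the products of the components of Z with the
    partial derivatives of F. *)
Lemma smooth_dirD c k l (F : M -> 'M[R]_(k, l)) (Z : M -> V) :
  smooth_mx c F -> smooth_mx c (fun x => Z x *m jac c x) ->
  smooth_mx c (fun x => dirD x (Z x) F).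
Proof.
move=> CF CZ i j; apply: (@smooth_in_eq _ _ _ _ (fun x => \sum_a (Z x *m jac c x) 0 a *
    'D_(delta_mx 0 a) ((fun y => F y i j) \o param c) (xcoord c x))).
  move=> x cx; rewrite dirD_mxE; last exact: dirD_exists_mx CF cx.
  by rewrite (proj2 (smooth_in_dirDE _ (CF i j) cx)).
apply: smooth_in_sum => a; apply: smooth_inM => //.
apply: (Cinfty_eq (open_cimage (c := c))); last exact: (Cinfty_derive a (CF i j)).
by move=> v vc /=; rewrite param_xcoord.
Qed.

Lemma smoothTP (X : M -> V) :
  smoothT X <-> forall c, smooth_mx c (fun x => X x *m jac c x).
Proof.
split=> H c.
  move=> i j; rewrite (ord1 i); apply: smooth_in_eq (H c j) => x cx.
  by rewrite vcompE.
by move=> j; apply: smooth_in_eq (H c 0 j) => x cx; rewrite vcompE.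
Qed.

Lemma smoothLP (X : M -> W) :
  smoothL X <-> forall c, smooth_mx c (fun x => X x *m frame c x).
Proof.
split=> [/smoothTP H c|H].
  apply: smooth_mx_eq (smooth_lsubmx (H c)) => x cx.
  by rewrite mul_jac // /inL !row_mxKl.
apply/smoothTP => c.
apply: smooth_mx_eq (smooth_row_mx (H c) (@smooth_mx_cst _ _ _ c _ _ (0 : W))) => x cx.
by rewrite mul_jac // /inL row_mxKl row_mxKr mul0mx.
Qed.

(** Matrix of a bilinear form of L in the coordinate frame of c. *)
Definition loc_form c (h : M -> 'M[R]_m) x : 'M[R]_m :=
  invmx (frame c x) *m h x *m (invmx (frame c x))^T.

Lemma smoothLLP (h : M -> 'M[R]_m) : smoothLL h <-> forall c, smooth_mx c (loc_form c h).
Proof.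
have E c i j x : cdom c x ->
    bilin h x (basisL c i x) (basisL c j x) = loc_form c h x i j.
  move=> cx; rewrite /bilin !basisLE // trmx_mul !mulmxA -!(mulmxA (delta_mx 0 i)).
  by rewrite trmx_delta -rowE -colE !mxE.
by split=> H c i j; apply: smooth_in_eq (H c i j) => x cx; rewrite E.
Qed.

End DirectionalDerivativesOnManifold.

(** * Linear algebra of the Christoffel term *)

Section ChristoffelAlgebra.
Variables (R : realType) (m : nat).
Local Notation V := 'rV[R]_(m + m).
Local Notation W := 'rV[R]_m.
Implicit Types (A B : 'M[R]_m) (v z : V) (w y u : W).

(** The form [bilin] at a single point, without reference to the manifold. *)
Definition bil y A w : R := (y *m A *m w^T) 0 0.

Lemma bilDl y y' A w : bil (y + y') A w = bil y A w + bil y' A w.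
Proof. by rewrite /bil !mulmxDl mxE. Qed.
Lemma bilDr y A w w' : bil y A (w + w') = bil y A w + bil y A w'.
Proof. by rewrite /bil linearD mulmxDr mxE. Qed.
Lemma bilDm y A B w : bil y (A + B) w = bil y A w + bil y B w.
Proof. by rewrite /bil mulmxDr mulmxDl mxE. Qed.
Lemma bilZl a y A w : bil (a *: y) A w = a * bil y A w.
Proof. by rewrite /bil -!scalemxAl mxE. Qed.
Lemma bilZr a y A w : bil y A (a *: w) = a * bil y A w.
Proof. by rewrite /bil linearZ -scalemxAr mxE. Qed.
Lemma bilZm a y A w : bil y (a *: A) w = a * bil y A w.
Proof. by rewrite /bil -scalemxAr -scalemxAl mxE. Qed.
Lemma bilNl y A w : bil (- y) A w = - bil y A w.
Proof. by rewrite -scaleN1r bilZl mulN1r. Qed.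
Lemma bilNr y A w : bil y A (- w) = - bil y A w.
Proof. by rewrite -scaleN1r bilZr mulN1r. Qed.
Lemma bilNm y A w : bil y (- A) w = - bil y A w.
Proof. by rewrite -scaleN1r bilZm mulN1r. Qed.
Lemma bil0l A w : bil 0 A w = 0.
Proof. by rewrite /bil !mul0mx mxE. Qed.
Lemma bil0r y A : bil y A 0 = 0.
Proof. by rewrite /bil trmx0 mulmx0 mxE. Qed.
Lemma bil0m y w : bil y 0 w = 0.
Proof. by rewrite /bil mulmx0 mul0mx mxE. Qed.
Lemma bil_tr y A w : bil y A w = bil w A^T y.
Proof. by rewrite /bil -[in LHS](trmxK (y *m A *m w^T)) mxE !trmx_mul trmxK mulmxA. Qed.

Lemma bil_inj A y y' : A \in unitmx -> (forall w, bil y A w = bil y' A w) -> y = y'.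
Proof.
move=> uA E; apply: (can_inj (mulmxK uA)); apply/rowP => j.
by have := E (delta_mx 0 j); rewrite /bil trmx_delta -!colE !mxE.
Qed.

(** A linear form is the pairing with its row of values on the canonical basis. *)
Lemma bil_row (f : W -> R) w : (forall a w w', f (a *: w + w') = a * f w + f w') ->
  (((\row_k f (delta_mx 0 k)) : W) *m w^T) 0 0 = f w.
Proof.
move=> lf; have f0 : f 0 = 0.
  by have := lf (- 1) 0 0; rewrite scaler0 addr0 mulN1r addNr.
rewrite [in RHS](row_sum_delta w) mxE.
apply: (big_rec2 (fun s t => s = f t)) => [|k s t _ ->]; first by rewrite f0.
by rewrite lf !mxE mulrC.
Qed.

Definition leaf_vec w : V := row_mx w 0.
(** The point of the graph of B above w; the graphs of B + g and B - g are S_+ and S_-. *)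
Definition graph_vec B w : V := row_mx w (w *m B).

Definition mx_linear (d : V -> 'M[R]_m) :=
  forall a v z, d (a *: v + z) = a *: d v + d z.

Lemma mx_linear0 d : mx_linear d -> d 0 = 0.
Proof. by move=> ld; have := ld (- 1) 0 0; rewrite scaler0 addr0 scaleN1r addNr. Qed.

Lemma leaf_vec0 : leaf_vec 0 = 0.
Proof. by rewrite /leaf_vec row_mx0. Qed.

Lemma graph_vec0 B : graph_vec B 0 = 0.
Proof. by rewrite /graph_vec mul0mx row_mx0. Qed.

(** Koszul expression of the Christoffel term for the metric with derivative dH. *)
Definition lc_form (dH : V -> 'M[R]_m) u y w : R :=
  2^-1 * (bil y (dH (leaf_vec u)) w + bil u (dH (leaf_vec y)) w - bil u (dH (leaf_vec w)) y).

(** Zeroth order part of gamma([u_-, y_+]_0, w_+), where u_- is the vector of the graph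
    of Q above u and y_+, w_+ are those of the graph of P above y and w. *)
Definition mixed_form (P Q : 'M[R]_m) (dP dQ : V -> 'M[R]_m) u y w : R :=
  bil y (dP (graph_vec Q u)) w - bil u (dQ (graph_vec P y)) w
  + bil u (dQ (graph_vec P w)) y.

(** [graph_vec Q] of it is the component along graph(Q), parallel to L; [leaf_part] gives the
    component in L. *)
Definition graph_part Q z : W := rsubmx z *m invmx Q.
Definition leaf_part Q z : W := lsubmx z - graph_part Q z.

(** The pairing, for the metric P - Q, of the Christoffel term with w. *)
Definition christ_form (P Q : 'M[R]_m) (dP dQ : V -> 'M[R]_m) z y w : R :=
  lc_form (fun v => dP v - dQ v) (leaf_part Q z) y w
  + mixed_form P Q dP dQ (graph_part Q z) y w.

Definition christoffel P Q dP dQ z y : W :=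
  (\row_k christ_form P Q dP dQ z y (delta_mx 0 k)) *m invmx (P - Q).

Lemma leaf_graph_sum Q z : Q \in unitmx ->
  z = leaf_vec (leaf_part Q z) + graph_vec Q (graph_part Q z).
Proof.
move=> uQ; rewrite add_row_mx add0r /leaf_part subrK /graph_part mulmxKV //.
by rewrite hsubmxK.
Qed.

Lemma graph_part_inl Q w : graph_part Q (leaf_vec w) = 0.
Proof. by rewrite /graph_part row_mxKr mul0mx. Qed.

Lemma leaf_part_inl Q w : leaf_part Q (leaf_vec w) = w.
Proof. by rewrite /leaf_part graph_part_inl row_mxKl subr0. Qed.

Lemma graph_part_graph Q w : Q \in unitmx -> graph_part Q (graph_vec Q w) = w.
Proof. by move=> uQ; rewrite /graph_part row_mxKr mulmxK. Qed.

Lemma leaf_part_graph Q w : Q \in unitmx -> leaf_part Q (graph_vec Q w) = 0.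
Proof. by move=> uQ; rewrite /leaf_part graph_part_graph // row_mxKl subrr. Qed.

Lemma graph_part_linear Q a v z :
  graph_part Q (a *: v + z) = a *: graph_part Q v + graph_part Q z.
Proof. by rewrite /graph_part linearP mulmxDl -scalemxAl. Qed.

Lemma leaf_part_linear Q a v z :
  leaf_part Q (a *: v + z) = a *: leaf_part Q v + leaf_part Q z.
Proof. by rewrite /leaf_part graph_part_linear linearP scalerBr opprD addrACA. Qed.

Lemma leaf_vec_linear a w y : leaf_vec (a *: w + y) = a *: leaf_vec w + leaf_vec y.
Proof. by rewrite /leaf_vec scale_row_mx add_row_mx scaler0 addr0. Qed.

Lemma graph_vec_linear B a w y : graph_vec B (a *: w + y) = a *: graph_vec B w + graph_vec B y.
Proof. by rewrite /graph_vec scale_row_mx add_row_mx mulmxDl -scalemxAl. Qed.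

Section Jet.
Variables (P Q : 'M[R]_m) (dP dQ : V -> 'M[R]_m).
Hypotheses (lP : mx_linear dP) (lQ : mx_linear dQ).

Let bilE := (bilDl, bilDr, bilDm, bilZl, bilZr, bilZm, bilNl, bilNr, bilNm, bil0l, bil0r).

Let jetE := (bilE, lP, lQ, leaf_vec_linear, graph_vec_linear).

Lemma christ_form_linearr z y a w w' : christ_form P Q dP dQ z y (a *: w + w') =
  a * christ_form P Q dP dQ z y w + christ_form P Q dP dQ z y w'.
Proof. by rewrite /christ_form /lc_form /mixed_form !jetE; ring. Qed.

Lemma christ_form_linearm z y y' a w : christ_form P Q dP dQ z (a *: y + y') w =
  a * christ_form P Q dP dQ z y w + christ_form P Q dP dQ z y' w.
Proof. by rewrite /christ_form /lc_form /mixed_form !jetE; ring. Qed.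

Lemma christ_form_linearl z z' y a w : christ_form P Q dP dQ (a *: z + z') y w =
  a * christ_form P Q dP dQ z y w + christ_form P Q dP dQ z' y w.
Proof.
rewrite /christ_form /lc_form /mixed_form leaf_part_linear graph_part_linear !jetE.
by ring.
Qed.

Lemma christoffel_linearm z y y' a : christoffel P Q dP dQ z (a *: y + y') =
  a *: christoffel P Q dP dQ z y + christoffel P Q dP dQ z y'.
Proof.
rewrite /christoffel scalemxAl -mulmxDl; congr (_ *m _); apply/rowP => k.
by rewrite !mxE christ_form_linearm.
Qed.

Lemma christoffel_linearl z z' y a : christoffel P Q dP dQ (a *: z + z') y =
  a *: christoffel P Q dP dQ z y + christoffel P Q dP dQ z' y.
Proof.
rewrite /christoffel scalemxAl -mulmxDl; congr (_ *m _); apply/rowP => k.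
by rewrite !mxE christ_form_linearl.
Qed.

Hypothesis uH : P - Q \in unitmx.

Lemma christoffelP z y w :
  bil (christoffel P Q dP dQ z y) (P - Q) w = christ_form P Q dP dQ z y w.
Proof.
rewrite /bil /christoffel mulmxKV //.
exact: (bil_row _ (christ_form_linearr z y)).
Qed.

Hypothesis skewd : forall v, (dP v)^T = - dQ v.

Let skewd' v : (dQ v)^T = - dP v.
Proof. by rewrite -[dQ v]opprK -skewd linearN /= trmxK. Qed.

(** The Christoffel term of the Levi-Civita connection is symmetric as dP - dQ has
    symmetric values. *)
Lemma christ_form_leaf_sym u y w :
  christ_form P Q dP dQ (leaf_vec u) y w = christ_form P Q dP dQ (leaf_vec y) u w.
Proof.
rewrite /christ_form /lc_form /mixed_form !graph_part_inl !leaf_part_inl !bilE.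
rewrite [bil y (dP (leaf_vec w)) _]bil_tr [bil y (dQ (leaf_vec w)) _]bil_tr.
by rewrite skewd skewd' graph_vec0 (mx_linear0 lP) !bil0m !bilE; ring.
Qed.

Lemma christoffel_leaf_sym u y :
  christoffel P Q dP dQ (leaf_vec u) y = christoffel P Q dP dQ (leaf_vec y) u.
Proof. by apply: (bil_inj uH) => w; rewrite !christoffelP christ_form_leaf_sym. Qed.

Hypothesis uQ : Q \in unitmx.

(** On the leaf component this is the metric property of the Levi-Civita connection. On the
    graph component, the two terms with dQ are exchanged by y <-> w and cancel, and the
    term with dP symmetrizes to the derivative of P - Q because dP^T = - dQ. *)
Lemma christ_form_metric z y w :
  christ_form P Q dP dQ z y w + christ_form P Q dP dQ z w y = bil y (dP z - dQ z) w.
Proof.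
have dD (d : V -> 'M[R]_m) v v' : mx_linear d -> d (v + v') = d v + d v'.
  by move=> ld; rewrite -[v]scale1r ld !scale1r.
rewrite /christ_form /lc_form /mixed_form.
set u := leaf_part Q z; set t := graph_part Q z.
have dz (d : V -> 'M[R]_m) : mx_linear d -> d z = d (leaf_vec u) + d (graph_vec Q t).
  by move=> ld; rewrite -(dD _ _ _ ld) -leaf_graph_sum.
rewrite (dz _ lP) (dz _ lQ).
rewrite !bilE.
rewrite [bil w (dP (leaf_vec u)) _]bil_tr [bil w (dQ (leaf_vec u)) _]bil_tr.
rewrite [bil w (dP (graph_vec Q t)) _]bil_tr.
by rewrite !skewd skewd' !bilE; field.
Qed.

Lemma christ_form_graph u y w :
  christ_form P Q dP dQ (graph_vec Q u) y w = mixed_form P Q dP dQ u y w.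
Proof.
rewrite /christ_form leaf_part_graph // graph_part_graph // /lc_form leaf_vec0.
by rewrite !(mx_linear0 lP) !(mx_linear0 lQ) subrr !bil0m !bilE; ring.
Qed.

End Jet.

Section FrameChange.
Variables (P Q P' Q' a : 'M[R]_m) (dP dQ dP' dQ' : V -> 'M[R]_m).
Hypotheses (ua : a \in unitmx) (uQ : Q \in unitmx).
Let b := invmx a.
Let J : 'M[R]_(m + m) := block_mx a 0 0 (invmx a)^T.
Hypotheses (PE : P' = b *m P *m b^T) (QE : Q' = b *m Q *m b^T).
Hypotheses (dPE : forall v, dP' (v *m J) = b *m dP v *m b^T)
           (dQE : forall v, dQ' (v *m J) = b *m dQ v *m b^T).

Let bil_frame y A w : bil (y *m a) (b *m A *m b^T) (w *m a) = bil y A w.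
Proof.
rewrite /bil !mulmxA mulmxK // -!mulmxA -trmx_mul.
by rewrite mulmxK.
Qed.

Let leaf_vec_frame w : leaf_vec (w *m a) = leaf_vec w *m J.
Proof. by rewrite /leaf_vec mul_row_block !mulmx0 !mul0mx !addr0. Qed.

Let graph_frame B w : graph_vec (b *m B *m b^T) (w *m a) = graph_vec B w *m J.
Proof.
rewrite /graph_vec mul_row_block !mulmx0 add0r addr0 !mulmxA mulmxK //.
Qed.

Lemma graph_part_frame z : graph_part Q' (z *m J) = graph_part Q z *m a.
Proof.
rewrite /graph_part QE -{1}[z]hsubmxK mul_row_block !mulmx0 add0r row_mxKr.
have ub : b \in unitmx by rewrite unitmx_inv.
have ubt : b^T \in unitmx by rewrite unitmx_tr.
apply: (can_inj (mulmxK (_ : b *m Q *m b^T \in unitmx))).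
  by rewrite !unitmx_mul ub uQ.
by rewrite mulmxKV ?unitmx_mul ?ub ?uQ // !mulmxA mulmxK // mulmxKV.
Qed.

Lemma leaf_part_frame z : leaf_part Q' (z *m J) = leaf_part Q z *m a.
Proof.
rewrite /leaf_part graph_part_frame -{1}[z]hsubmxK mul_row_block !mulmx0 addr0.
by rewrite row_mxKl mulmxBl.
Qed.

Lemma christ_form_frame z y w :
  christ_form P' Q' dP' dQ' (z *m J) (y *m a) (w *m a) = christ_form P Q dP dQ z y w.
Proof.
rewrite /christ_form leaf_part_frame graph_part_frame /lc_form /mixed_form.
rewrite PE QE !graph_frame !leaf_vec_frame !dPE !dQE -!mulmxBl -!mulmxBr.
by rewrite !bil_frame.
Qed.

(** Each summand of [christ_form] is the value of a bilinear form, or of the derivative of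
    one, on vectors; such values do not depend on the frame. *)
Lemma christoffel_frame z y : mx_linear dP -> mx_linear dQ ->
  mx_linear dP' -> mx_linear dQ' -> P - Q \in unitmx ->
  christoffel P' Q' dP' dQ' (z *m J) (y *m a) = christoffel P Q dP dQ z y *m a.
Proof.
move=> lP lQ lP' lQ' uH.
have HE : P' - Q' = b *m (P - Q) *m b^T by rewrite PE QE mulmxBr mulmxBl.
have uH' : P' - Q' \in unitmx.
  by rewrite HE !unitmx_mul unitmx_tr unitmx_inv ua uH.
apply: (bil_inj uH') => w; rewrite christoffelP // -(mulmxKV ua w) -/b.
by rewrite HE bil_frame christoffelP // christ_form_frame.
Qed.

End FrameChange.
End ChristoffelAlgebra.

Lemma invmx_mul (R : comUnitRingType) n (A B : 'M[R]_n) :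
  A \in unitmx -> B \in unitmx -> invmx (A *m B) = invmx B *m invmx A.
Proof.
move=> uA uB; apply: (can_inj (mulKmx (_ : A *m B \in unitmx))).
  by rewrite unitmx_mul uA.
by rewrite mulmxV ?unitmx_mul ?uA // -mulmxA mulKVmx // mulmxV.
Qed.

Lemma linear_scale (R : pzRingType) (E E' : lmodType R) (f : E -> E') :
  (forall u v a, f (a *: u + v) = a *: f u + f v) -> forall a u, f (a *: u) = a *: f u.
Proof.
move=> lf a u; have f0 : f 0 = 0.
  by have := lf 0 0 (- 1); rewrite scaler0 addr0 scaleN1r addNr.
by rewrite -[a *: u]addr0 lf f0 addr0.
Qed.

Lemma linear_add (R : pzRingType) (E E' : lmodType R) (f : E -> E') :
  (forall u v a, f (a *: u + v) = a *: f u + f v) -> forall u v, f (u + v) = f u + f v.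
Proof. by move=> lf u v; rewrite -[u in LHS]scale1r lf scale1r. Qed.

(** * The connection on L defined by a pair of forms *)

Section PairConnection.
Variables (R : realType) (m : nat) (M : fblManifold R m).
Local Notation V := 'rV[R]_(m + m).
Local Notation W := 'rV[R]_m.
Implicit Types (c : chart M) (x y : M) (v : V) (X Y : M -> W) (Z : M -> V).

(** Components of a section of L in the coordinate frame of c. *)
Definition loc_sec c Y x : W := Y x *m frame c x.

Lemma loc_sec_chart_at x Y : loc_sec (chart_at x) Y x = Y x.
Proof. by rewrite /loc_sec frame_chart_at mulmx1. Qed.

Lemma loc_form_chart_at x h : loc_form (chart_at x) h x = h x.
Proof. by rewrite /loc_form frame_chart_at invmx1 trmx1 mulmx1 mul1mx. Qed.

Lemma near_loc_sec c x Y : cdom c x ->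
  \forall y \near x, loc_sec (chart_at x) Y y *m frame c x = loc_sec c Y y.
Proof.
move=> cx; apply: filterS (near_frame_chart_at cx) => y E.
by rewrite /loc_sec E mulmxA.
Qed.

Lemma near_loc_form c x h : cdom c x ->
  \forall y \near x, invmx (frame c x) *m loc_form (chart_at x) h y *m (invmx (frame c x))^T
    = loc_form c h y.
Proof.
move=> cx; near=> y.
have dy : cdom (chart_at x) y by near: y; exact: nbhs_cdom (chart_atP x).
rewrite /loc_form (near (near_frame_chart_at cx) y) // invmx_mul ?unit_frame //.
by rewrite trmx_mul !mulmxA.
Unshelve. all: by end_near. Qed.

Lemma smooth_loc_sec c Y : smoothL Y -> smooth_mx c (loc_sec c Y).
Proof. by move=> /smoothLP. Qed.

Lemma loc_sec_exists c x v Y : smoothL Y -> cdom c x -> dirD_exists x v (loc_sec c Y).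
Proof. by move=> sY; apply: dirD_exists_mx; exact: smooth_loc_sec. Qed.

Lemma loc_form_exists c x v h : smoothLL h -> cdom c x -> dirD_exists x v (loc_form c h).
Proof. by move=> /smoothLLP sh; apply: dirD_exists_mx. Qed.

Lemma dirD_exists_cst (T : normedModType R) (a : T) x v : dirD_exists x v (fun=> a).
Proof. exact: derivable_cst. Qed.

Lemma dirD_loc_sec c x v Y : smoothL Y -> cdom c x ->
  dirD x v (loc_sec c Y) = dirD x v (loc_sec (chart_at x) Y) *m frame c x.
Proof.
move=> sY cx.
apply: etrans (esym (near_dirD v (near_loc_sec Y cx))) _.
have dc : dirD_exists x v (fun=> frame c x) by exact: dirD_exists_cst.
apply: etrans (dirD_mulmx (loc_sec_exists sY (chart_atP x)) dc) _.
by rewrite dirD_cst mulmx0 addr0.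
Qed.

Lemma dirD_loc_form c x v h : smoothLL h -> cdom c x ->
  dirD x v (loc_form c h) =
  invmx (frame c x) *m dirD x v (loc_form (chart_at x) h) *m (invmx (frame c x))^T.
Proof.
move=> sh cx.
have dh : dirD_exists x v _ := loc_form_exists (v := v) sh (chart_atP x).
have dc k l (A : 'M[R]_(k, l)) : dirD_exists x v (fun=> A) by exact: dirD_exists_cst.
apply: etrans (esym (near_dirD v (near_loc_form h cx))) _.
apply: etrans (dirD_mulmx (dirD_exists_mulmx (dc _ _ _) dh) (dc _ _ _)) _.
rewrite dirD_cst mulmx0 addr0; congr (_ *m _).
by apply: etrans (dirD_mulmx (dc _ _ _) dh) _; rewrite dirD_cst mul0mx add0r.
Qed.

(** Since the frames of two charts differ by a locally constant matrix, this derivative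
    transforms like the form itself ([dirD_loc_form]). *)
Definition dform h x v : 'M[R]_m := dirD x v (loc_form (chart_at x) h).

Lemma dform_linear h x : smoothLL h -> mx_linear (dform h x).
Proof. by move=> /smoothLLP sh a v w; apply: dirD_linear (sh _) (chart_atP x). Qed.

Lemma smooth_bil c (y w : M -> W) (A : M -> 'M[R]_m) :
  smooth_mx c y -> smooth_mx c A -> smooth_mx c w ->
  smooth_in c (fun x => bil (y x) (A x) (w x)).
Proof.
by move=> sy sA sw; apply: (smooth_mxM (smooth_mxM sy sA) (smooth_mxT sw)).
Qed.

Lemma smooth_graph_vec c (B : M -> 'M[R]_m) (w : M -> W) :
  smooth_mx c B -> smooth_mx c w -> smooth_mx c (fun x => graph_vec (B x) (w x)).
Proof. by move=> sB sw; apply: smooth_row_mx => //; exact: smooth_mxM. Qed.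

Lemma smooth_leaf_vec c (w : M -> W) : smooth_mx c w -> smooth_mx c (fun x => leaf_vec (w x)).
Proof. by move=> sw; apply: smooth_row_mx => //; exact: smooth_mx_cst. Qed.

Variables (P Q : M -> 'M[R]_m).
Hypotheses (sP : smoothLL P) (sQ : smoothLL Q).
Hypothesis uQ : forall x, Q x \in unitmx.
Hypothesis uH : forall x, P x - Q x \in unitmx.

(** The leading term is the flat connection of the chart chosen at x. *)
Definition pair_conn (Z : M -> V) (Y : M -> W) (x : M) : W :=
  dirD x (Z x) (loc_sec (chart_at x) Y) +
  christoffel (P x) (Q x) (dform P x) (dform Q x) (Z x) (Y x).

Let chart_form c (h : M -> 'M[R]_m) x v := dirD x (v *m invmx (jac c x)) (loc_form c h).

(** The defining formula, written at each x in a different chart, has the same form in one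
    fixed chart c; smoothness follows from this. *)
Lemma pair_conn_chart c Z Y x : smoothL Y -> cdom c x ->
  loc_sec c (pair_conn Z Y) x = dirD x (Z x) (loc_sec c Y) +
  christoffel (loc_form c P x) (loc_form c Q x) (chart_form c P x) (chart_form c Q x)
    (Z x *m jac c x) (loc_sec c Y x).
Proof.
move=> sY cx; rewrite {1}/loc_sec mulmxDl -dirD_loc_sec //; congr (_ + _).
have uJ := unit_jac cx.
have aP h : smoothLL h -> mx_linear (chart_form c h x).
  move=> /smoothLLP sh a v w; rewrite /chart_form mulmxDl -scalemxAl.
  exact: dirD_linear (sh _) cx.
rewrite /loc_sec jacE //; symmetry; apply: christoffel_frame => //.
- exact: unit_frame.
- by move=> v; rewrite -jacE // /chart_form mulmxK // dirD_loc_form.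
- by move=> v; rewrite -jacE // /chart_form mulmxK // dirD_loc_form.
- exact: dform_linear.
- exact: dform_linear.
- exact: aP.
- exact: aP.
Qed.

Lemma smooth_chart_form c h (v : M -> V) : smoothLL h -> smooth_mx c v ->
  smooth_mx c (fun x => chart_form c h x (v x)).
Proof.
move=> /smoothLLP sh sv; apply: smooth_dirD => //.
by apply: smooth_mx_eq sv => x cx; rewrite mulmxKV // unit_jac.
Qed.

Lemma unit_loc_form c h x : cdom c x -> h x \in unitmx -> loc_form c h x \in unitmx.
Proof.
by move=> cx uh; rewrite /loc_form !unitmx_mul unitmx_tr unitmx_inv unit_frame // uh.
Qed.

Lemma loc_formB c h h' x : loc_form c (fun y => h y - h' y) x = loc_form c h x - loc_form c h' x.
Proof. by rewrite /loc_form mulmxBr mulmxBl. Qed.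

Lemma smooth_pair_conn Z Y : smoothT Z -> smoothL Y -> smoothL (pair_conn Z Y).
Proof.
move=> /smoothTP sZ sY; apply/smoothLP => c.
have sYc := smooth_loc_sec c sY.
have sPc := iffLR (smoothLLP P) sP c; have sQc := iffLR (smoothLLP Q) sQ c.
apply: smooth_mx_eq (fun x cx => esym (pair_conn_chart Z sY cx)) _.
apply: smooth_mxD; first exact: smooth_dirD.
have suQ : smooth_mx c (fun x => graph_part (loc_form c Q x) (Z x *m jac c x)).
  apply: smooth_mxM; first exact: smooth_rsubmx.
  by apply: smooth_invmx => // x cx; exact: unit_loc_form.
have slQ : smooth_mx c (fun x => leaf_part (loc_form c Q x) (Z x *m jac c x)).
  by apply: smooth_mxB => //; exact: smooth_lsubmx.
apply: smooth_mxM; last first.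
  apply: smooth_invmx; last exact: smooth_mxB.
  by move=> x cx; rewrite -loc_formB; exact: unit_loc_form.
apply: smooth_row => k.
have se : smooth_mx c (fun=> (delta_mx 0 k : W)) by exact: smooth_mx_cst.
have sB (f g : M -> R) : smooth_in c f -> smooth_in c g -> smooth_in c (fun x => f x - g x).
  move=> sf sg; have := smooth_inD sf (smooth_inM (smooth_in_cst c (- 1)) sg).
  by apply: smooth_in_eq => x _ /=; rewrite mulN1r.
have sd (v : M -> V) : smooth_mx c v -> smooth_mx c (fun x => chart_form c P x (v x) - chart_form c Q x (v x)).
  by move=> sv; apply: smooth_mxB; exact: smooth_chart_form.
apply: smooth_inD.
  apply: smooth_inM; first exact: smooth_in_cst.
  apply: sB; first apply: smooth_inD; apply: smooth_bil => //; apply: sd; exact: smooth_leaf_vec.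
apply: smooth_inD; first apply: sB; apply: smooth_bil => //;
  apply: smooth_chart_form => //; exact: smooth_graph_vec.
Qed.

Lemma dirD_fun (f : M -> R) x v : smooth f -> dirD_exists x v (f : M -> R^o).
Proof. by move=> sf; have [] := smooth_in_dirDE v (sf (chart_at x)) (chart_atP x). Qed.

Lemma pair_conn_connection : is_connection id (@smoothT _ _ M) (@smoothL _ _ M) pair_conn.
Proof.
have chart_e x v Y : smoothL Y -> dirD_exists x v (loc_sec (chart_at x) Y).
  by move=> sY; exact: loc_sec_exists sY (chart_atP x).
have lP x := dform_linear x sP; have lQ x := dform_linear x sQ.
have Gamma_lin x (Z : M -> V) (u v : W) a :
    christoffel (P x) (Q x) (dform P x) (dform Q x) (Z x) (a *: u + v) =
    a *: christoffel (P x) (Q x) (dform P x) (dform Q x) (Z x) u +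
    christoffel (P x) (Q x) (dform P x) (dform Q x) (Z x) v.
  exact: christoffel_linearm.
split.
- exact: smooth_pair_conn.
- move=> f Z Z' X sf sZ sZ' sX x; rewrite /pair_conn scalerDr addrACA.
  congr (_ + _); last exact: christoffel_linearl.
  exact: dirD_linear (smooth_loc_sec _ sX) (chart_atP x).
- move=> Z X X' sZ sX sX' x; rewrite /pair_conn addrACA; congr (_ + _); last first.
    exact: (linear_add (Gamma_lin x Z)).
  have -> : loc_sec (chart_at x) (fun y => X y + X' y) =
      (fun y => loc_sec (chart_at x) X y + loc_sec (chart_at x) X' y).
    by apply/funext => y; rewrite /loc_sec mulmxDl.
  by apply: dirDD; exact: chart_e.
- move=> f Z X sf sZ sX x; rewrite /pair_conn scalerDr addrA; congr (_ + _); last first.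
    exact: (linear_scale (Gamma_lin x Z)).
  have -> : loc_sec (chart_at x) (fun y => f y *: X y) =
      (fun y => f y *: loc_sec (chart_at x) X y).
    by apply/funext => y; rewrite /loc_sec scalemxAl.
  apply: etrans (dirDZ (dirD_fun sf) (chart_e x _ _ sX)) _.
  by rewrite loc_sec_chart_at.
Qed.

End PairConnection.

(** * Metric, brackets and torsion of this connection *)

Section PairGeometry.
Variables (R : realType) (m : nat) (M : fblManifold R m).
Local Notation V := 'rV[R]_(m + m).
Local Notation W := 'rV[R]_m.
Implicit Types (c : chart M) (x y : M) (v : V) (X Y : M -> W) (Z : M -> V).

(** Derivative of a section of L for the flat connection. *)
Definition dsec X x v : W := dirD x v (loc_sec (chart_at x) X).

Definition graph_sec (B : M -> 'M[R]_m) X x : V := graph_vec (B x) (X x).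

Lemma loc_sec_form c X h x : cdom c x ->
  loc_sec c X x *m loc_form c h x = X x *m h x *m (invmx (frame c x))^T.
Proof.
by move=> cx; rewrite /loc_sec /loc_form !mulmxA mulmxK // unit_frame.
Qed.

Lemma bil_loc c X Y h x : cdom c x ->
  bil (loc_sec c X x) (loc_form c h x) (loc_sec c Y x) = bil (X x) (h x) (Y x).
Proof.
move=> cx; rewrite /bil loc_sec_form // /loc_sec trmx_mul -!mulmxA.
by rewrite (mulmxA (_^T) (_^T)) -trmx_mul mulmxV ?unit_frame // trmx1 mul1mx.
Qed.

Lemma dsec_exists x v X : smoothL X -> dirD_exists x v (loc_sec (chart_at x) X).
Proof. by move=> sX; exact: loc_sec_exists sX (chart_atP x). Qed.

Lemma dform_exists x v h : smoothLL h -> dirD_exists x v (loc_form (chart_at x) h).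
Proof. by move=> sh; exact: loc_form_exists sh (chart_atP x). Qed.

Lemma dirD_bil X Y h x v : smoothL X -> smoothL Y -> smoothLL h ->
  dirD x v ((fun y => bil (X y) (h y) (Y y)) : M -> R^o) =
  bil (dsec X x v) (h x) (Y x) + bil (X x) (dform h x v) (Y x) +
  bil (X x) (h x) (dsec Y x v).
Proof.
move=> sX sY sh; set d := chart_at x.
(* near x, the function is the entry of a product of matrices smooth in the chart *)
pose G y := loc_sec d X y *m loc_form d h y *m (loc_sec d Y y)^T.
have dX : dirD_exists x v (loc_sec d X) by exact: dsec_exists.
have dY : dirD_exists x v (loc_sec d Y) by exact: dsec_exists.
have dh : dirD_exists x v (loc_form d h) by exact: dform_exists.
have dYT : dirD_exists x v (fun y => (loc_sec d Y y)^T).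
  apply: (dirD_exists_mx (c := d)); last exact: chart_atP.
  by apply: smooth_mxT; exact: smooth_loc_sec.
have dXh := dirD_exists_mulmx dX dh.
have dG : dirD_exists x v G by exact: dirD_exists_mulmx.
transitivity (dirD x v G 0 0).
  rewrite (dirD_mxE 0 0 dG); apply: near_dirD.
  apply: filterS (nbhs_cdom (chart_atP x)) => y dy.
  by rewrite -(bil_loc X Y h dy).
rewrite (dirD_mulmx dXh dYT) (dirD_mulmx dX dh) (dirD_trmx dY) -/(dsec X x v).
rewrite -/(dform h x v) -/(dsec Y x v) /d !loc_sec_chart_at loc_form_chart_at.
by rewrite mulmxDl [LHS]mxE [X in X + _ = _]mxE.
Qed.

Lemma row_mx_split k l p (A : 'M[R]_(k, l)) (B : 'M[R]_(k, p)) :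
  row_mx A B = A *m row_mx 1%:M 0 + B *m row_mx 0 1%:M.
Proof. by rewrite !mul_mx_row !mulmx1 !mulmx0 add_row_mx addr0 add0r. Qed.

Lemma dirD_row_mx k l p (F : M -> 'M[R]_(k, l)) (G : M -> 'M[R]_(k, p)) x v :
  dirD_exists x v F -> dirD_exists x v G ->
  dirD x v (fun y => row_mx (F y) (G y)) = row_mx (dirD x v F) (dirD x v G).
Proof.
move=> dF dG.
have dc a b (A : 'M[R]_(a, b)) : dirD_exists x v (fun=> A) by exact: dirD_exists_cst.
have -> : (fun y => row_mx (F y) (G y)) =
    (fun y => F y *m row_mx 1%:M 0 + G y *m row_mx 0 1%:M).
  by apply/funext => y; exact: row_mx_split.
rewrite [RHS]row_mx_split.
apply: etrans (dirDD (dirD_exists_mulmx dF (dc _ _ _)) (dirD_exists_mulmx dG (dc _ _ _))) _.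
by congr (_ + _); apply: etrans (dirD_mulmx _ (dc _ _ _)) _ => //; rewrite dirD_cst mulmx0 addr0.
Qed.

Lemma nabla0_inL x v Y : smoothL Y -> nabla0 x v (inL Y) = row_mx (dsec Y x v) 0.
Proof.
move=> sY; set d := chart_at x.
have dY : dirD_exists x v (loc_sec d Y) by exact: dsec_exists.
transitivity (dirD x v (fun y => row_mx (loc_sec d Y y) (0 : W))).
  apply: near_dirD; apply: filterS (nbhs_cdom (chart_atP x)) => y dy.
  by rewrite vcompE // mul_jac // /inL row_mxKl row_mxKr mul0mx.
have d0 : dirD_exists x v (fun=> (0 : W)) by exact: dirD_exists_cst.
apply: etrans (dirD_row_mx dY d0) _.
by rewrite dirD_cst.
Qed.

Lemma graph_sec_jac c B X x : cdom c x ->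
  graph_sec B X x *m jac c x = row_mx (loc_sec c X x) (loc_sec c X x *m loc_form c B x).
Proof.
by move=> cx; rewrite mul_jac // /graph_sec /graph_vec row_mxKl row_mxKr loc_sec_form.
Qed.

Lemma smooth_graph_sec B X : smoothLL B -> smoothL X -> smoothT (graph_sec B X).
Proof.
move=> /smoothLLP sB /smoothLP sX; apply/smoothTP => c.
apply: smooth_mx_eq (fun x cx => esym (graph_sec_jac B X cx)) _.
by apply: smooth_row_mx => //; apply: smooth_mxM.
Qed.

(** Leibniz rule in Y B; the second component is what distinguishes the derivative of the
    lifted section from the lift of the derivative. *)
Lemma nabla0_graph x v B Y : smoothLL B -> smoothL Y ->
  nabla0 x v (graph_sec B Y) =
  row_mx (dsec Y x v) (dsec Y x v *m B x + Y x *m dform B x v).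
Proof.
move=> sB sY; set d := chart_at x.
have dY : dirD_exists x v (loc_sec d Y) by exact: dsec_exists.
have dB : dirD_exists x v (loc_form d B) by exact: dform_exists.
transitivity (dirD x v (fun y => row_mx (loc_sec d Y y)
    (loc_sec d Y y *m loc_form d B y))).
  apply: near_dirD; apply: filterS (nbhs_cdom (chart_atP x)) => y dy.
  by rewrite vcompE // graph_sec_jac.
apply: etrans (dirD_row_mx dY (dirD_exists_mulmx dY dB)) _.
by rewrite (dirD_mulmx dY dB) loc_sec_chart_at loc_form_chart_at.
Qed.

Definition dot (a b : W) : R := (a *m b^T) 0 0.

Lemma dotDl a a' b : dot (a + a') b = dot a b + dot a' b.
Proof. by rewrite /dot mulmxDl mxE. Qed.
Lemma dotC a b : dot a b = dot b a.
Proof. by rewrite /dot -[a *m b^T]trmxK mxE trmx_mul trmxK. Qed.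
Lemma dot_mul a A b : dot (a *m A) b = bil a A b.
Proof. by []. Qed.

Lemma gamma_row (a b a' b' : W) :
  gamma (row_mx a b) (row_mx a' b') = dot b a' + dot b' a.
Proof. by rewrite /gamma !row_mxKl !row_mxKr mxE addrC (dotC b'). Qed.

Lemma gammaC (v w : V) : gamma v w = gamma w v.
Proof. by rewrite -[v]hsubmxK -[w]hsubmxK !gamma_row addrC. Qed.

Lemma gammaDl (v v' w : V) : gamma (v + v') w = gamma v w + gamma v' w.
Proof. by rewrite /gamma !linearD !mulmxDl !mxE; ring. Qed.

Lemma gammaZl a (v w : V) : gamma (a *: v) w = a * gamma v w.
Proof. by rewrite /gamma !linearZ -!scalemxAl !mxE; ring. Qed.

Lemma gammaNl (v w : V) : gamma (- v) w = - gamma v w.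
Proof. by rewrite -scaleN1r gammaZl mulN1r. Qed.

(** The derivatives x1, x2 of X and y2 of Y drop out because the graphs of P and Q are
    orthogonal; y1 survives, paired by P - Q. *)
Lemma mixed_bracket_algebra (P Q dPu dQy dPw dQw : 'M[R]_m) (u y w y1 x1 y2 x2 : W) :
  P^T = - Q -> Q^T = - P -> dPw^T = - dQw ->
  gamma (row_mx y1 (y1 *m P + y *m dPu) - row_mx x1 (x1 *m Q + u *m dQy)) (graph_vec P w)
  - 2^-1 * (gamma (graph_vec Q u) (row_mx y2 (y2 *m P + y *m dPw)) -
            gamma (graph_vec P y) (row_mx x2 (x2 *m Q + u *m dQw))) =
  bil y1 (P - Q) w + (bil y dPu w - bil u dQy w + bil u dQw y).
Proof.
move=> PT QT dT; rewrite gammaDl gammaNl !gamma_row !dotDl !dot_mul.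
rewrite [bil w P y1]bil_tr [bil w P x1]bil_tr [bil u Q y2]bil_tr [bil y P x2]bil_tr.
rewrite [bil y dPw u]bil_tr PT QT dT !(bilDm, bilNm).
by field.
Qed.

(** Unbundled version, for forms whose linearity is only a hypothesis. *)
Lemma gamma_sharp_linear (om : V -> R) (z : V) :
  (forall a v w, om (a *: v + w) = a * om v + om w) -> gamma z (sharp_gamma om) = om z.
Proof.
move=> lin.
pose L : {linear V -> R^o} := HB.pack om (GRing.isLinear.Build R V R^o _ om lin).
exact: (gamma_sharp L).
Qed.

Lemma nabla0_linear x (Y : M -> V) a (v w : V) : smoothT Y ->
  nabla0 x (a *: v + w) Y = a *: nabla0 x v Y + nabla0 x w Y.
Proof.
move=> sY; apply: (dirD_linear (c := chart_at x)); last exact: chart_atP.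
by move=> i j; rewrite (ord1 i); exact: sY.
Qed.

Lemma gamma_half_diff_linear (f g : V -> V) (u u' : V) :
  (forall a v w, f (a *: v + w) = a *: f v + f w) ->
  (forall a v w, g (a *: v + w) = a *: g v + g w) ->
  let om z := 2^-1 * (gamma u (f z) - gamma u' (g z)) in
  forall a v w, om (a *: v + w) = a * om v + om w.
Proof.
move=> lf lg om a v w; rewrite /om lf lg !(gammaC u) !(gammaC u') !gammaDl !gammaZl.
by ring.
Qed.

Lemma gamma_wedge0 (X Y : M -> V) x z : smoothT X -> smoothT Y ->
  gamma (wedge0 X Y x) z =
  2^-1 * (gamma (X x) (nabla0 x z Y) - gamma (Y x) (nabla0 x z X)).
Proof.
move=> sX sY; rewrite gammaC; apply: gamma_sharp_linear.
by apply: gamma_half_diff_linear => a v w; exact: nabla0_linear.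
Qed.

Variables (P Q : M -> 'M[R]_m).
Hypotheses (sP : smoothLL P) (sQ : smoothLL Q).
Hypothesis skewPQ : forall x, (P x)^T = - Q x.
Hypothesis uQ : forall x, Q x \in unitmx.
Hypothesis uH : forall x, P x - Q x \in unitmx.

Let skewQP x : (Q x)^T = - P x.
Proof. by rewrite -[Q x]opprK -skewPQ linearN /= trmxK. Qed.

Lemma smoothLL_diff : smoothLL (fun x => P x - Q x).
Proof.
move: sP sQ => /smoothLLP sP' /smoothLLP sQ'; apply/smoothLLP => c.
apply: smooth_mx_eq (smooth_mxB (sP' c) (sQ' c)) => x _.
by rewrite loc_formB.
Qed.

Lemma dformB x v : dform (fun x => P x - Q x) x v = dform P x v - dform Q x v.
Proof.
have dP := dform_exists (v := v) (x := x) sP; have dQ := dform_exists (v := v) (x := x) sQ.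
apply: etrans (dirDB dP dQ); congr dirD; apply/funext => y; exact: loc_formB.
Qed.

Lemma loc_form_tr c x : (loc_form c P x)^T = - loc_form c Q x.
Proof. by rewrite /loc_form !trmx_mul trmxK skewPQ mulmxA mulmxN mulNmx. Qed.

Lemma dform_tr x v : (dform P x v)^T = - dform Q x v.
Proof.
have dP := dform_exists (v := v) (x := x) sP; have dQ := dform_exists (v := v) (x := x) sQ.
apply: etrans (esym (dirD_trmx dP)) _; apply: etrans (dirDN dQ).
by congr dirD; apply/funext => y; exact: loc_form_tr.
Qed.

Lemma bil_pair_conn Z Y x w :
  bil (pair_conn P Q Z Y x) (P x - Q x) w =
  bil (dsec Y x (Z x)) (P x - Q x) w +
  christ_form (P x) (Q x) (dform P x) (dform Q x) (Z x) (Y x) w.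
Proof.
rewrite bilDl; congr (_ + _); apply: christoffelP (uH x) _ _ _; exact: dform_linear.
Qed.

Lemma pair_conn_metric Z X Y x : smoothL X -> smoothL Y ->
  dirD x (Z x) ((fun y => bil (X y) (P y - Q y) (Y y)) : M -> R^o) =
  bil (pair_conn P Q Z X x) (P x - Q x) (Y x) + bil (X x) (P x - Q x) (pair_conn P Q Z Y x).
Proof.
move=> sX sY; have symH : (P x - Q x)^T = P x - Q x.
  by rewrite linearB /= skewPQ skewQP opprK addrC.
rewrite (dirD_bil _ _ sX sY smoothLL_diff) dformB.
rewrite [bil (X x) _ (pair_conn _ _ _ _ _)]bil_tr [bil (X x) _ (dsec _ _ _)]bil_tr symH.
rewrite !bil_pair_conn.
have := christ_form_metric (P x) (dform_linear x sP) (dform_linear x sQ) (dform_tr x)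
  (uQ x) (Z x) (X x) (Y x).
by move=> <-; ring.
Qed.

Lemma gamma_graph B B' (u w : W) x :
  gamma (graph_vec (B x) u) (graph_vec (B' x) w) = bil u (B x + (B' x)^T) w.
Proof. by rewrite gamma_row !dot_mul bilDm [bil w _ _]bil_tr. Qed.

Lemma gamma_graph_same (u w : W) x :
  gamma (graph_vec (P x) u) (graph_vec (P x) w) = bil u (P x - Q x) w.
Proof. by rewrite gamma_graph skewPQ. Qed.

Lemma gamma_graph_mixed (u w : W) x :
  gamma (graph_vec (Q x) u) (graph_vec (P x) w) = 0.
Proof. by rewrite gamma_graph skewPQ subrr bil0m. Qed.

(** The prescription of the connection along the graph of Q by the metric bracket. *)
Lemma gamma_bracket_mixed X Y x w : smoothL X -> smoothL Y ->
  gamma (bracket0 (graph_sec Q X) (graph_sec P Y) x) (graph_vec (P x) w) =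
  bil (pair_conn P Q (graph_sec Q X) Y x) (P x - Q x) w.
Proof.
move=> sX sY.
have sgX := smooth_graph_sec sQ sX; have sgY := smooth_graph_sec sP sY.
rewrite bil_pair_conn christ_form_graph //; do ?exact: dform_linear.
rewrite /bracket0 gammaDl gammaNl (gamma_wedge0 _ _ sgX sgY) /lie_bracket.
rewrite -!/(nabla0 _ _ _) !(nabla0_graph _ _ sP sY) !(nabla0_graph _ _ sQ sX).
by apply: mixed_bracket_algebra; [exact: skewPQ | exact: skewQP | exact: dform_tr].
Qed.

Lemma pair_conn_torsion_free X Y x : smoothL X -> smoothL Y ->
  inL (pair_conn P Q (inL X) Y) x - inL (pair_conn P Q (inL Y) X) x =
  lie_bracket (inL X) (inL Y) x.
Proof.
move=> sX sY; rewrite /lie_bracket -!/(nabla0 _ _ _) !nabla0_inL //.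
rewrite /inL !opp_row_mx !add_row_mx !oppr0 !addr0; congr row_mx.
rewrite /pair_conn -!/(dsec _ _ _) [X in _ - X]addrC.
have -> : christoffel (P x) (Q x) (dform P x) (dform Q x) (row_mx (X x) 0) (Y x) =
          christoffel (P x) (Q x) (dform P x) (dform Q x) (row_mx (Y x) 0) (X x).
  apply: christoffel_leaf_sym => //; [exact: dform_linear|exact: dform_linear|].
  exact: dform_tr.
exact: addrKA.
Qed.

Lemma restrL_pair_connection : is_connection (@inL _ _ M) (@smoothL _ _ M) (@smoothL _ _ M)
  (restrL (pair_conn P Q)).
Proof.
have [H1 H2 H3 H4] := pair_conn_connection sP sQ uQ uH.
split=> [Z X sZ sX|f Z Z' X sf sZ sZ' sX x|Z X X' sZ sX sX' x|f Z X sf sZ sX x].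
- exact: (H1 (inL Z) X sZ sX).
- apply: etrans (H2 f (inL Z) (inL Z') X sf sZ sZ' sX x).
  congr (pair_conn P Q _ X x); apply/funext => y.
  by rewrite /inL scale_row_mx add_row_mx scaler0 addr0.
- exact: (H3 (inL Z) X X' sZ sX sX' x).
- exact: (H4 f (inL Z) X sf sZ sX x).
Qed.

End PairGeometry.

(** * Bump functions and sections with a given value *)

Section TestSections.
Variables (R : realType) (m : nat) (M : fblManifold R m).
Local Notation V := 'rV[R]_(m + m).
Local Notation W := 'rV[R]_m.
Implicit Types (c : chart M) (x y : M) (v : V).

(** Used with functions given near each point by a formula, like a bump extended by 0. *)
Lemma Ck_near_smooth k (U : set V) (f : V -> R) :
  (forall v, v \in U -> exists2 g, Cinfty setT g & \forall w \near v, g w = f w) ->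
  Ck k U f.
Proof.
move=> H; apply: Ck_local => v /H[g Cg gf].
exists (interior [set w | g w = f w]).
  exact: (nbhs_interior gf).
apply: (Ck_eq (open_interior _) _ (Ck_subset (@subsetT _ _) (Cg k))).
by move=> w /set_mem/interior_subset.
Qed.

(** A polynomial in place of a norm, positive at v0 and negative outside of a cube. *)
Definition quad (v0 : V) (r : R) v := r ^+ 2 - \sum_i (v 0 i - v0 0 i) ^+ 2.

Definition bump v0 r v := flat_exp 1 (quad v0 r v).

Lemma Cinfty_bump_affine v0 r (K : 'M[R]_(m + m)) t :
  Cinfty setT (fun w : V => bump v0 r (w *m K + t)).
Proof.
have oT : open [set: V] by exact: openT.
apply: (Cinfty_flat oT 1).
have Ccoord i : Cinfty [set: V] (fun w : V => (w *m K + t) 0 i - v0 0 i).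
  suff : Cinfty [set: V] (fun w => \sum_j w 0 j * K j i + (t 0 i - v0 0 i)).
    by apply: (Cinfty_eq oT) => w _; rewrite !mxE addrA.
  apply: CinftyD; [exact: oT | | exact: Cinfty_cst].
  apply: Cinfty_sum => // j; apply: CinftyM => //; [exact: Cinfty_coord|exact: Cinfty_cst].
suff : Cinfty [set: V] (fun w => r ^+ 2 + (-1) * \sum_i
    (((w *m K + t) 0 i - v0 0 i) * ((w *m K + t) 0 i - v0 0 i))).
  by move=> H; apply: (Cinfty_eq oT _ H) => w _; rewrite /quad -[- \sum_i _]mulN1r; congr (_ + _ * _).
apply: CinftyD; [exact: oT | exact: Cinfty_cst |].
apply: CinftyM; [exact: oT | exact: Cinfty_cst |].
by apply: Cinfty_sum => // i; apply: CinftyM.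
Qed.

Lemma bump_outside v0 r v i : 0 < r -> r < `|v 0 i - v0 0 i| -> bump v0 r v = 0.
Proof.
move=> r0 ri; apply: flat_le0; rewrite /quad subr_le0 (bigD1 i) //=.
have : r ^+ 2 <= (v 0 i - v0 0 i) ^+ 2.
  by rewrite -(real_normK (num_real (_ - _))) ler_pXn2r ?nnegrE // ltW.
by move=> H; rewrite -[leLHS]addr0 lerD // sumr_ge0 // => j _; rewrite sqr_ge0.
Qed.

Lemma bump_center v0 r : 0 < r -> bump v0 r v0 != 0.
Proof.
move=> r0; rewrite /bump /flat_exp /quad big1 => [|i _]; last by rewrite subrr expr0n.
by rewrite subr0 exprn_gt0 // hornerC mul1r gt_eqF // expR_gt0.
Qed.

(** A multiple, by a bump function in the coordinates, of a coordinate-constant section. The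
    support of the bump is compact, hence closed since M is Hausdorff, and this makes the
    extension by 0 smooth. *)
Lemma exists_section x (w : W) : exists2 Y : M -> W, smoothL Y & Y x = w.
Proof.
pose c := chart_at x; have cx : cdom c x by exact: chart_atP.
pose v0 := xcoord c x.
have [e /= e0 eI] : exists2 e : R, 0 < e & forall v, `|v0 - v| < e -> cimage c v.
  have := nbhs_in_open (open_cimage (c := c)) (xcoord_cimage cx).
  by move=> /nbhs_normP[e /= e0 H]; exists e => // v; exact: H.
pose r := e / 2; have r0 : 0 < r by exact: divr_gt0.
pose K := [set v : V | forall i, `[v0 0 i - r, v0 0 i + r]%classic (v ord0 i)].
have cK : compact K.
  apply: (@rV_compact _ _ (fun i => `[v0 0 i - r, v0 0 i + r]%classic)) => i.
  exact: segment_compact.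
have KI : K `<=` cimage c.
  move=> v Kv; apply: eI; apply: (@le_lt_trans _ _ r); last first.
    by rewrite /r ltr_pdivrMr // ltr_pMr // ltr1n.
  rewrite [leLHS]/Num.norm /= mx_normrE; apply: bigmax_le; first exact: ltW.
  move=> [a b] _; rewrite (ord1 a) !mxE distrC ler_distl.
  by have := Kv b; rewrite /= in_itv.
pose K' := param c @` K.
have clK' : closed K'.
  apply: compact_closed; first exact: fbl_hausdorff.
  apply: continuous_compact cK; apply: continuous_in_subspaceT => v /set_mem/KI vI.
  by apply: param_continuous; exact: mem_set.
pose f y : R := if `[< cdom c y >] then bump v0 r (xcoord c y) else 0.
have f_out y : ~ K' y -> f y = 0.
  move=> nK; rewrite /f; case: ifPn => // /asboolP cy.
  have : ~ K (xcoord c y) by move=> Ky; apply: nK; exists (xcoord c y); rewrite ?paramK.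
  move=> /existsNP[i]; rewrite /= in_itv /= -ler_distl => /negP; rewrite -ltNge => H.
  exact: bump_outside r0 H.
have fx : f x != 0 by rewrite /f asboolT // bump_center.
pose w' : W := (f x)^-1 *: w.
pose Y y := f y *: (w' *m invmx (frame c y)).
exists Y; last first.
  by rewrite /Y frame_chart_at invmx1 mulmx1 /w' scalerA mulfV // scale1r.
apply/smoothLP => c' i j k; apply: Ck_near_smooth => v vI.
have cv := param_cimage vI; have [cy|ncy] := pselect (cdom c (param c' v)).
- (* in cdom c, the section is the bump times a vector constant in coordinates *)
  have [a _ Ea] := near_frame cv cy.
  have [b _ [t Et]] := affine_change_transition cy cv.
  set K0 := block_mx _ _ _ _ in Et.
  exists (fun z : V => bump v0 r (z *m K0 + t) * (w' *m a) i j).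
    apply: CinftyM; [exact: openT | exact: Cinfty_bump_affine | ].
    by apply: Cinfty_cst; exact: openT.
  have H : \forall y \near param c' v, bump v0 r (xcoord c' y *m K0 + t) *
      (w' *m a) i j = (Y y *m frame c' y) i j.
    near=> y; have cy' : cdom c y by near: y; exact: nbhs_cdom.
    rewrite -(near Et y) // (near Ea y) // /Y /f asboolT // -scalemxAl [RHS]mxE.
    by rewrite !mulmxA mulmxKV // unit_frame.
  have := near_param cv H; rewrite (param_xcoord vI) => H'.
  near=> z; have zI : z \in cimage c'.
    by apply: mem_set; near: z; apply: nbhs_in_open => //; exact: open_cimage.
  rewrite /= -[in LHS](param_xcoord zI); near: z; exact: H'.
- exists (cst 0); first by apply: Cinfty_cst; exact: openT.
  have H : \forall y \near param c' v, 0 = (Y y *m frame c' y) i j.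
    have : nbhs (param c' v) (~` K').
      apply: open_nbhs_nbhs; split; first exact: closed_openC.
      by move=> [z /KI zI zE]; apply: ncy; rewrite -zE; apply: param_cimage; exact: mem_set.
    by apply: filterS => y nK; rewrite /Y f_out // scale0r mul0mx mxE.
  by have := near_param cv H; rewrite (param_xcoord vI).
Unshelve. all: by end_near. Qed.

End TestSections.

(** * Projections onto the two graphs *)

Section Splitting.
Variables (R : realType) (m : nat).
Local Notation V := 'rV[R]_(m + m).
Local Notation W := 'rV[R]_m.
Implicit Types (P Q : 'M[R]_m) (v : V).

(** [graph_vec P] of it is the component of v in graph(P), parallel to graph(Q). *)
Definition graph_proj P Q v : W := (rsubmx v - lsubmx v *m Q) *m invmx (P - Q).

Lemma graph_proj_same P Q (w : W) : P - Q \in unitmx ->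
  graph_proj P Q (graph_vec P w) = w.
Proof.
by move=> uH; rewrite /graph_proj row_mxKl row_mxKr -mulmxBr mulmxK.
Qed.

Lemma graph_proj_other P Q (w : W) : graph_proj P Q (graph_vec Q w) = 0.
Proof. by rewrite /graph_proj row_mxKl row_mxKr subrr mul0mx. Qed.

Lemma graph_proj_linear P Q a v v' :
  graph_proj P Q (a *: v + v') = a *: graph_proj P Q v + graph_proj P Q v'.
Proof.
rewrite /graph_proj !linearP [in RHS]scalemxAl -[RHS]mulmxDl; congr (_ *m _).
by rewrite mulmxDl -scalemxAl scalerBr opprD addrACA.
Qed.

Lemma graph_proj_sum P Q v : P - Q \in unitmx ->
  v = graph_vec P (graph_proj P Q v) + graph_vec Q (graph_proj Q P v).
Proof.
move=> uH; have uH' : Q - P \in unitmx.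
  by rewrite -opprB -scaleN1r unitmxZ // unitrN1.
have E : graph_proj P Q v + graph_proj Q P v = lsubmx v.
  have invN : invmx (Q - P) = - invmx (P - Q).
    apply: (can_inj (mulKmx uH')); rewrite mulmxV // mulmxN -mulNmx opprB.
    by rewrite mulmxV.
  rewrite /graph_proj invN mulmxN -mulmxBl opprB addrC addrA subrK.
  by rewrite -mulmxBr mulmxK.
rewrite /graph_vec add_row_mx E -[LHS]hsubmxK; congr row_mx.
set p := graph_proj P Q v; have -> : p *m P = p *m (P - Q) + p *m Q.
  by rewrite -mulmxDr subrK.
by rewrite -addrA -mulmxDl E /p /graph_proj mulmxKV // subrK.
Qed.

End Splitting.

(** * Uniqueness along the leaves *)

Section Uniqueness.
Variables (R : realType) (m : nat) (M : fblManifold R m).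
Local Notation V := 'rV[R]_(m + m).
Local Notation W := 'rV[R]_m.
Implicit Types (x : M) (X Y U : M -> W) (Z : M -> V).

Lemma smooth_cst (a : R) : smooth (fun _ : M => a).
Proof. by move=> c; exact: smooth_in_cst. Qed.

Lemma connection_addl (A E : lmodType R) (a : (M -> A) -> M -> V) GA GE
    (D : (M -> A) -> (M -> E) -> M -> E) (Z Z' : M -> A) (X : M -> E) x :
  is_connection a GA GE D -> GA Z -> GA Z' -> GE X ->
  D (fun y => Z y + Z' y) X x = D Z X x + D Z' X x.
Proof.
move=> [_ H _ _] gZ gZ' gX.
have := H _ _ _ _ (smooth_cst 1) gZ gZ' gX x; rewrite scale1r => <-.
by congr (D _ X x); apply/funext => y; rewrite scale1r.
Qed.

(** Nondegeneracy tested on global sections only. *)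
Lemma bil_test_sections x A (w w' : W) : A \in unitmx ->
  (forall Y, smoothL Y -> bil w A (Y x) = bil w' A (Y x)) -> w = w'.
Proof.
move=> uA H; apply: (bil_inj uA) => u.
by have [Y sY <-] := exists_section x u; exact: H.
Qed.

(** The difference S(A, B, C) = g(D1_A B - D2_A B, C) is symmetric in A, B and
    skew-symmetric in B, C, hence zero. *)
Lemma levi_civita_unique p q (F : gBfield M p q) D1 D2 X Y x : gf F x \in unitmx ->
  levi_civita F D1 -> levi_civita F D2 -> smoothL X -> smoothL Y ->
  D1 X Y x = D2 X Y x.
Proof.
move=> ug [_ m1 t1] [_ m2 t2] sX sY.
pose S A B C := bil (D1 A B x) (gf F x) (C x) - bil (D2 A B x) (gf F x) (C x).
have S_skew A B C : smoothL A -> smoothL B -> smoothL C -> S A B C = - S A C B.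
  move=> sA sB sC; have := m1 A B C sA sB sC x.
  rewrite (m2 A B C sA sB sC x) /bilin -!/(bil _ _ _).
  have sym u w : bil u (gf F x) w = bil w (gf F x) u by rewrite bil_tr gf_sym.
  rewrite [bil (B x) _ (D1 _ _ _)]sym [bil (B x) _ (D2 _ _ _)]sym /S => E.
  by apply/eqP; rewrite -subr_eq0 opprK; apply/eqP; lra.
have S_sym A B C : smoothL A -> smoothL B -> S A B C = S B A C.
  move=> sA sB; have := t1 A B sA sB x; rewrite -(t2 A B sA sB x).
  move=> /(congr1 lsubmx); rewrite !linearB /= !row_mxKl => E.
  have {}E : D1 A B x - D2 A B x = D1 B A x - D2 B A x.
    by apply/eqP; rewrite subr_eq addrAC -addrA addrC -subr_eq E.
  by rewrite /S -!bilNl -!bilDl E.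
apply: (bil_test_sections (x := x) ug) => C sC; apply/eqP; rewrite -subr_eq0.
have S0 : S X Y C = - S X Y C.
  rewrite {1}S_skew // S_sym // S_skew // opprK S_sym // S_skew // S_sym //.
by apply/eqP; rewrite -/(S X Y C); lra.
Qed.

End Uniqueness.

(** * The connection on the tangent bundle *)

Section CombinedConnection.
Variables (R : realType) (m : nat) (M : fblManifold R m).
Local Notation V := 'rV[R]_(m + m).
Local Notation W := 'rV[R]_m.
Implicit Types (c : chart M) (x : M) (X Y U : M -> W) (Z : M -> V).

Lemma connection_zero (A E : lmodType R) (a : (M -> A) -> M -> V) GA GE
    (D : (M -> A) -> (M -> E) -> M -> E) (Z : M -> A) x :
  is_connection a GA GE D -> GA Z -> GE (fun=> 0) -> D Z (fun=> 0) x = 0.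
Proof.
move=> [_ _ H _] gZ g0; have := H Z _ _ gZ g0 g0 x.
have -> : (fun y : M => (0 : E) + 0) = (fun=> 0) by apply/funext => y; rewrite addr0.
by move/eqP; rewrite -subr_eq0 opprD addNKr oppr_eq0 => /eqP.
Qed.

Lemma smoothL0 : smoothL (fun _ : M => 0 : W).
Proof.
apply/smoothLP => c; apply: smooth_mx_eq (smooth_mx_cst c (0 : W)) => x _.
by rewrite mul0mx.
Qed.

Lemma smoothTD Z Z' : smoothT Z -> smoothT Z' -> smoothT (fun x => Z x + Z' x).
Proof.
move=> /smoothTP sZ /smoothTP sZ'; apply/smoothTP => c.
by apply: smooth_mx_eq (smooth_mxD (sZ c) (sZ' c)) => x _; rewrite mulmxDl.
Qed.

Definition proj_sec (P Q : M -> 'M[R]_m) Z x : W := graph_proj (P x) (Q x) (Z x).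

Lemma smooth_proj_sec P Q Z : smoothLL P -> smoothLL Q ->
  (forall x, P x - Q x \in unitmx) -> smoothT Z -> smoothL (proj_sec P Q Z).
Proof.
move=> /smoothLLP sP /smoothLLP sQ uH /smoothTP sZ; apply/smoothLP => c.
pose G x := graph_proj (loc_form c P x) (loc_form c Q x) (Z x *m jac c x).
have sG : smooth_mx c G.
  apply: smooth_mxM.
    apply: smooth_mxB; first exact: smooth_rsubmx.
    by apply: smooth_mxM => //; exact: smooth_lsubmx.
  apply: smooth_invmx; last exact: smooth_mxB.
  by move=> x cx; rewrite -loc_formB; exact: unit_loc_form.
apply: smooth_mx_eq sG => x cx; rewrite /G {1}(graph_proj_sum (Z x) (uH x)).
rewrite mulmxDl.
have := graph_sec_jac P (proj_sec P Q Z) cx; rewrite /graph_sec => ->.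
have := graph_sec_jac Q (proj_sec Q P Z) cx; rewrite /graph_sec => ->.
rewrite -!/(graph_vec _ _) -[graph_vec _ (loc_sec _ _ _)]scale1r graph_proj_linear.
rewrite graph_proj_other addr0 scale1r graph_proj_same //.
by rewrite -loc_formB; exact: unit_loc_form.
Qed.

(** In a chart the components of Z and the matrix of Q are smooth, and so is the quotient. *)
Lemma smooth_graph_part Q Z : smoothLL Q -> (forall x, Q x \in unitmx) -> smoothT Z ->
  smoothL (fun x => graph_part (Q x) (Z x)).
Proof.
move=> /smoothLLP sQ uQ /smoothTP sZ; apply/smoothLP => c.
have sG : smooth_mx c (fun x => graph_part (loc_form c Q x) (Z x *m jac c x)).
  apply: smooth_mxM; first exact: smooth_rsubmx.
  by apply: smooth_invmx => // x cx; exact: unit_loc_form.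
apply: smooth_mx_eq sG => x cx; rewrite jacE //.
by apply: graph_part_frame => //; exact: unit_frame.
Qed.

Lemma smooth_leaf_part Q Z : smoothLL Q -> (forall x, Q x \in unitmx) -> smoothT Z ->
  smoothL (fun x => leaf_part (Q x) (Z x)).
Proof.
move=> sQ uQ sZ; have /smoothLP sG := smooth_graph_part sQ uQ sZ.
move/smoothTP: sZ => sZ; apply/smoothLP => c.
apply: smooth_mx_eq (smooth_mxB (smooth_lsubmx (sZ c)) (sG c)) => x cx.
by rewrite mul_jac // row_mxKl mulmxBl.
Qed.

(** All the terms pairing the graph of P with the graph of Q vanish. *)
Lemma mixed_torsionE P Q (nabla : (M -> V) -> (M -> V) -> M -> V) X Y U x (a b b' d : W) :
  (forall x, (P x)^T = - Q x) ->
  nabla (graph_sec Q X) (graph_sec P Y) x = graph_vec (P x) a ->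
  nabla (graph_sec P Y) (graph_sec Q X) x = graph_vec (Q x) b ->
  nabla (graph_sec P U) (graph_sec Q X) x = graph_vec (Q x) b' ->
  nabla (graph_sec P U) (graph_sec P Y) x = graph_vec (P x) d ->
  gualtieri_torsion nabla (graph_sec Q X) (graph_sec P Y) (graph_sec P U) x =
  bil a (P x - Q x) (U x) -
  gamma (bracket0 (graph_sec Q X) (graph_sec P Y) x) (graph_vec (P x) (U x)).
Proof.
move=> skew E1 E2 E3 E4; rewrite /gualtieri_torsion E1 E2 E3 E4.
move: (bracket0 _ _ x) => br; rewrite /graph_sec !gammaDl !gammaNl.
rewrite (gammaC (graph_vec (P x) d)) !(gamma_graph_mixed skew).
by rewrite (gamma_graph_same skew) !subr0 mulr0 addr0.
Qed.

Variables (P Q : M -> 'M[R]_m).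
Hypotheses (sP : smoothLL P) (sQ : smoothLL Q).
Hypothesis skewPQ : forall x, (P x)^T = - Q x.
Hypothesis (uP : forall x, P x \in unitmx) (uQ : forall x, Q x \in unitmx).
Hypothesis uH : forall x, P x - Q x \in unitmx.

Let uH' x : Q x - P x \in unitmx.
Proof. by rewrite -opprB -scaleN1r unitmxZ ?unitrN1. Qed.

Let skewQP x : (Q x)^T = - P x.
Proof. by rewrite -[Q x]opprK -skewPQ linearN /= trmxK. Qed.

Definition comb_conn (Z Y : M -> V) x : V :=
  graph_vec (P x) (pair_conn P Q Z (proj_sec P Q Y) x) +
  graph_vec (Q x) (pair_conn Q P Z (proj_sec Q P Y) x).

Let cP := pair_conn_connection sP sQ uQ uH.
Let cQ := pair_conn_connection sQ sP uP uH'.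

Let sp Z : smoothT Z -> smoothL (proj_sec P Q Z).
Proof. exact: smooth_proj_sec. Qed.
Let sp' Z : smoothT Z -> smoothL (proj_sec Q P Z).
Proof. exact: smooth_proj_sec. Qed.

Lemma graph_vecD (A : 'M[R]_m) (u w : W) :
  graph_vec A (u + w) = graph_vec A u + graph_vec A w.
Proof. by rewrite -[u in LHS]scale1r graph_vec_linear scale1r. Qed.

Lemma graph_vecZ (A : 'M[R]_m) a (u : W) : graph_vec A (a *: u) = a *: graph_vec A u.
Proof. by rewrite -[a *: u]addr0 graph_vec_linear graph_vec0 addr0. Qed.

Lemma graph_vec_addACA (A B : 'M[R]_m) (u u' w w' : W) :
  graph_vec A (u + u') + graph_vec B (w + w') =
  (graph_vec A u + graph_vec B w) + (graph_vec A u' + graph_vec B w').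
Proof. by rewrite !graph_vecD addrACA. Qed.

Lemma graph_vec_comb (A B : 'M[R]_m) (a b : R) (u u' w w' : W) :
  graph_vec A (a *: u + b *: u') + graph_vec B (a *: w + b *: w') =
  a *: (graph_vec A u + graph_vec B w) + b *: (graph_vec A u' + graph_vec B w').
Proof. by rewrite graph_vec_addACA !graph_vecZ -!scalerDr. Qed.

Lemma comb_conn_graph Z X x : smoothT Z -> smoothL X ->
  comb_conn Z (graph_sec P X) x = graph_vec (P x) (pair_conn P Q Z X x) /\
  comb_conn Z (graph_sec Q X) x = graph_vec (Q x) (pair_conn Q P Z X x).
Proof.
move=> sZ sX.
have p1 : proj_sec P Q (graph_sec P X) = X.
  by apply/funext => y; exact: graph_proj_same.
have p2 : proj_sec Q P (graph_sec P X) = fun=> 0.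
  by apply/funext => y; exact: graph_proj_other.
have p3 : proj_sec P Q (graph_sec Q X) = fun=> 0.
  by apply/funext => y; exact: graph_proj_other.
have p4 : proj_sec Q P (graph_sec Q X) = X.
  by apply/funext => y; exact: graph_proj_same.
rewrite /comb_conn p1 p2 p3 p4 (connection_zero x cP sZ smoothL0).
by rewrite (connection_zero x cQ sZ smoothL0) !graph_vec0 addr0 add0r.
Qed.

Lemma comb_conn_connection : is_connection id (@smoothT _ _ M) (@smoothT _ _ M) comb_conn.
Proof.
have [P1 P2 P3 P4] := cP; have [Q1 Q2 Q3 Q4] := cQ.
split.
- move=> Z X sZ sX.
  have sPX := P1 _ _ sZ (sp sX); have sQX := Q1 _ _ sZ (sp' sX).
  exact: (smoothTD (smooth_graph_sec sP sPX) (smooth_graph_sec sQ sQX)).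
- move=> f Z Z' X sf sZ sZ' sX x.
  rewrite /comb_conn (P2 f Z Z' _ sf sZ sZ' (sp sX)) (Q2 f Z Z' _ sf sZ sZ' (sp' sX)).
  by rewrite !graph_vec_linear scalerDr; exact: addrACA.
- move=> Z X X' sZ sX sX' x; rewrite /comb_conn.
  have E A B : proj_sec A B (fun y => X y + X' y) =
      (fun y => proj_sec A B X y + proj_sec A B X' y).
    by apply/funext => y; rewrite /proj_sec -[X y]scale1r graph_proj_linear !scale1r.
  rewrite !E (P3 Z _ _ sZ (sp sX) (sp sX')) (Q3 Z _ _ sZ (sp' sX) (sp' sX')).
  exact: graph_vec_addACA.
- move=> f Z X sf sZ sX x; rewrite /comb_conn.
  have E A B : proj_sec A B (fun y => f y *: X y) = (fun y => f y *: proj_sec A B X y).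
    apply/funext => y; rewrite /proj_sec.
    by apply: (linear_scale (f := graph_proj (A y) (B y))) => u v a; exact: graph_proj_linear.
  rewrite !E (P4 f Z _ sf sZ (sp sX)) (Q4 f Z _ sf sZ (sp' sX)).
  by rewrite graph_vec_comb /proj_sec -(graph_proj_sum (X x) (uH x)).
Qed.

(** gamma is the case s = 1, and the generalized metric the case s = - 1. *)
Definition split_form (s : R) x (v w : V) : R :=
  bil (graph_proj (P x) (Q x) v) (P x - Q x) (graph_proj (P x) (Q x) w) +
  s * bil (graph_proj (Q x) (P x) v) (Q x - P x) (graph_proj (Q x) (P x) w).

Let graph_proj_split x (u w : W) :
  graph_proj (P x) (Q x) (graph_vec (P x) u + graph_vec (Q x) w) = u /\
  graph_proj (Q x) (P x) (graph_vec (P x) u + graph_vec (Q x) w) = w.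
Proof.
rewrite -[graph_vec (P x) u]scale1r !graph_proj_linear !graph_proj_other.
by rewrite !graph_proj_same // scale1r scaler0 addr0 add0r.
Qed.

Lemma split_form_graphl s x (u w : W) v :
  split_form s x (graph_vec (P x) u + graph_vec (Q x) w) v =
  bil u (P x - Q x) (graph_proj (P x) (Q x) v) +
  s * bil w (Q x - P x) (graph_proj (Q x) (P x) v).
Proof. by have [E1 E2] := graph_proj_split x u w; rewrite /split_form E1 E2. Qed.

Lemma split_form_graphr s x (u w : W) v :
  split_form s x v (graph_vec (P x) u + graph_vec (Q x) w) =
  bil (graph_proj (P x) (Q x) v) (P x - Q x) u +
  s * bil (graph_proj (Q x) (P x) v) (Q x - P x) w.
Proof. by have [E1 E2] := graph_proj_split x u w; rewrite /split_form E1 E2. Qed.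

Lemma bil_exists X Y h x v : smoothL X -> smoothL Y -> smoothLL h ->
  dirD_exists x v ((fun y => bil (X y) (h y) (Y y)) : M -> R^o).
Proof.
move=> sX sY /smoothLLP sh; have cx := chart_atP x.
have := smooth_in_dirDE v (smooth_bil (smooth_loc_sec (chart_at x) sX) (sh _)
  (smooth_loc_sec (chart_at x) sY)) cx => -[d _].
apply: near_dirD_exists d; apply: filterS (nbhs_cdom cx) => y cy.
exact: bil_loc.
Qed.

Lemma comb_conn_preserves s : preserves id (@smoothT _ _ M) (@smoothT _ _ M) (split_form s) comb_conn.
Proof.
move=> Z X Y sZ sX sY x; set f1 := fun y : M => bil (proj_sec P Q X y) (P y - Q y) (proj_sec P Q Y y) : R^o.
set f2 := fun y : M => bil (proj_sec Q P X y) (Q y - P y) (proj_sec Q P Y y) : R^o.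
have e1 : dirD_exists x (Z x) f1.
  exact: bil_exists (sp sX) (sp sY) (smoothLL_diff sP sQ).
have e2 : dirD_exists x (Z x) f2.
  exact: bil_exists (sp' sX) (sp' sY) (smoothLL_diff sQ sP).
have es : dirD_exists x (Z x) (fun=> s : R^o) by exact: dirD_exists_cst.
transitivity (dirD x (Z x) f1 + s * dirD x (Z x) f2).
  apply: etrans (dirDD e1 (dirD_existsM es e2)) _.
  by congr (_ + _); apply: etrans (dirDM es e2) _; rewrite dirD_cst mul0r add0r.
rewrite (pair_conn_metric sP sQ skewPQ uQ uH Z x (sp sX) (sp sY)).
rewrite (pair_conn_metric sQ sP skewQP uP uH' Z x (sp' sX) (sp' sY)).
apply: etrans (congr2 +%R (esym (split_form_graphl _ _ _ _ _)) (esym (split_form_graphr _ _ _ _ _))).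
by rewrite mulrDr; exact: addrACA.
Qed.

Lemma gamma_split : (fun _ : M => @gamma R m) = split_form 1.
Proof.
apply/funext => x; apply/funext => v; apply/funext => w.
rewrite {1}(graph_proj_sum v (uH x)) {1}(graph_proj_sum w (uH x)).
rewrite gammaDl ![gamma _ (_ + _)]gammaC !gammaDl.
rewrite /split_form mul1r.
rewrite (gamma_graph_mixed skewPQ) (gamma_graph_mixed skewQP) addr0 add0r.
rewrite (gamma_graph_same skewPQ) (gamma_graph_same skewQP).
by congr (_ + _); rewrite bil_tr linearB /= skewPQ skewQP opprK addrC.
Qed.

Lemma comb_conn_torsion X Y U x : smoothL X -> smoothL Y -> smoothL U ->
  gualtieri_torsion comb_conn (graph_sec Q X) (graph_sec P Y) (graph_sec P U) x = 0.
Proof.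
move=> sX sY sU.
have gP A : smoothL A -> smoothT (graph_sec P A) by exact: smooth_graph_sec.
have gQ A : smoothL A -> smoothT (graph_sec Q A) by exact: smooth_graph_sec.
have [E1 _] := comb_conn_graph x (gQ _ sX) sY.
have [_ E2] := comb_conn_graph x (gP _ sY) sX.
have [_ E3] := comb_conn_graph x (gP _ sU) sX.
have [E4 _] := comb_conn_graph x (gP _ sU) sY.
rewrite (mixed_torsionE skewPQ E1 E2 E3 E4).
by rewrite (gamma_bracket_mixed sP sQ skewPQ uQ uH x (U x) sX sY) subrr.
Qed.

End CombinedConnection.

(** * The connection of a field (g, B) *)

Section FieldConnection.
Variables (R : realType) (m : nat) (M : fblManifold R m) (p q : nat) (F : gBfield M p q).
Local Notation V := 'rV[R]_(m + m).
Local Notation W := 'rV[R]_m.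
Implicit Types (c : chart M) (x : M) (X Y U : M -> W) (Z : M -> V).

Definition flat_plus x : 'M[R]_m := Bf F x + gf F x.
Definition flat_minus x : 'M[R]_m := Bf F x - gf F x.

Lemma smooth_flat_plus : smoothLL flat_plus.
Proof.
have /smoothLLP sB := Bf_smooth F; have /smoothLLP sg := gf_smooth F.
apply/smoothLLP => c; apply: smooth_mx_eq (smooth_mxD (sB c) (sg c)) => x _.
by rewrite /loc_form mulmxDr mulmxDl.
Qed.

Lemma smooth_flat_minus : smoothLL flat_minus.
Proof.
have /smoothLLP sB := Bf_smooth F; have /smoothLLP sg := gf_smooth F.
apply/smoothLLP => c; apply: smooth_mx_eq (smooth_mxB (sB c) (sg c)) => x _.
by rewrite /loc_form mulmxBr mulmxBl.
Qed.

Lemma flat_skew x : (flat_plus x)^T = - flat_minus x.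
Proof. by rewrite /flat_plus /flat_minus linearD /= Bf_skew gf_sym opprB addrC. Qed.

Lemma flat_skew' x : (flat_minus x)^T = - flat_plus x.
Proof. by rewrite /flat_plus /flat_minus linearB /= Bf_skew gf_sym opprD. Qed.

Lemma flat_diff x : flat_plus x - flat_minus x = 2 *: gf F x.
Proof. by rewrite /flat_plus /flat_minus opprB addrC addrA subrK scaler_nat mulr2n. Qed.

Lemma flat_diff' x : flat_minus x - flat_plus x = (- 2) *: gf F x.
Proof. by rewrite -opprB flat_diff scaleNr. Qed.

Lemma unit_gf x : gf F x \in unitmx.
Proof.
have [A uA E] := gf_index F x.
have : A *m gf F x *m A^T \in unitmx.
  rewrite E unitmxE det_diag unitfE; apply/prodf_neq0 => i _; rewrite mxE.
  by case: ifP; rewrite ?oppr_eq0 oner_eq0.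
by rewrite !unitmx_mul => /andP[/andP[]].
Qed.

Lemma unit_flat_diff x : flat_plus x - flat_minus x \in unitmx.
Proof. by rewrite flat_diff unitmxZ ?unit_gf // unitfE pnatr_eq0. Qed.

Lemma unit_flat_diff' x : flat_minus x - flat_plus x \in unitmx.
Proof. by rewrite flat_diff' unitmxZ ?unit_gf // unitfE oppr_eq0 pnatr_eq0. Qed.

Hypothesis uP : forall x, flat_plus x \in unitmx.
Hypothesis uQ : forall x, flat_minus x \in unitmx.

Let sP := smooth_flat_plus.
Let sQ := smooth_flat_minus.

Definition Dplus := pair_conn flat_plus flat_minus.
Definition Dminus := pair_conn flat_minus flat_plus.
Definition nabla1 := comb_conn flat_plus flat_minus.

(** P - Q is 2 g for one pair and - 2 g for the other. *)
Lemma preserves_scaled (D : (M -> V) -> (M -> W) -> M -> W) (h : M -> 'M[R]_m) (k : R) :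
  k != 0 -> (forall x, h x = k *: gf F x) ->
  (forall Z X Y x, smoothL X -> smoothL Y ->
    dirD x (Z x) ((fun y => bil (X y) (h y) (Y y)) : M -> R^o) =
    bil (D Z X x) (h x) (Y x) + bil (X x) (h x) (D Z Y x)) ->
  preserves id (@smoothT _ _ M) (@smoothL _ _ M) (bilin (gf F)) D.
Proof.
move=> k0 hE H Z X Y sZ sX sY x.
apply: (mulfI k0); rewrite mulrDr -!bilZm -hE -(H Z X Y x sX sY).
have e : dirD_exists x (Z x) ((fun y => bil (X y) (gf F y) (Y y)) : M -> R^o).
  exact: bil_exists sX sY (gf_smooth F).
have ek : dirD_exists x (Z x) (fun=> k : R^o) by exact: dirD_exists_cst.
transitivity (dirD x (Z x) (fun y => k * bil (X y) (gf F y) (Y y) : R^o)).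
  by apply: etrans (esym (dirDM ek e)); rewrite dirD_cst mul0r add0r.
by congr dirD; apply/funext => y; rewrite hE bilZm.
Qed.

Lemma preserves_leaf (D : (M -> V) -> (M -> W) -> M -> W) :
  preserves id (@smoothT _ _ M) (@smoothL _ _ M) (bilin (gf F)) D ->
  preserves (@inL _ _ M) (@smoothL _ _ M) (@smoothL _ _ M) (bilin (gf F)) (restrL D).
Proof. by move=> H Z X Y sZ sX sY x; exact: (H (inL Z) X Y sZ sX sY x). Qed.

Lemma Dplus_metric : preserves id (@smoothT _ _ M) (@smoothL _ _ M) (bilin (gf F)) Dplus.
Proof.
apply: (preserves_scaled (k := 2) _ flat_diff) => [|Z X Y x sX sY].
  by rewrite pnatr_eq0.
exact: (pair_conn_metric sP sQ flat_skew uQ unit_flat_diff Z x sX sY).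
Qed.

Lemma Dminus_metric : preserves id (@smoothT _ _ M) (@smoothL _ _ M) (bilin (gf F)) Dminus.
Proof.
apply: (preserves_scaled (k := - 2) _ flat_diff') => [|Z X Y x sX sY].
  by rewrite oppr_eq0 pnatr_eq0.
exact: (pair_conn_metric sQ sP flat_skew' uP unit_flat_diff' Z x sX sY).
Qed.

Lemma Dplus_connection : is_connection id (@smoothT _ _ M) (@smoothL _ _ M) Dplus.
Proof. exact: (pair_conn_connection sP sQ uQ unit_flat_diff). Qed.

Lemma Dminus_connection : is_connection id (@smoothT _ _ M) (@smoothL _ _ M) Dminus.
Proof. exact: (pair_conn_connection sQ sP uP unit_flat_diff'). Qed.

Lemma Dplus_levi_civita : levi_civita F (restrL Dplus).
Proof.
split; first exact: (restrL_pair_connection sP sQ uQ unit_flat_diff).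
  exact: preserves_leaf Dplus_metric.
move=> X Y sX sY x.
exact: (pair_conn_torsion_free sP sQ flat_skew unit_flat_diff x sX sY).
Qed.

Lemma Dminus_levi_civita : levi_civita F (restrL Dminus).
Proof.
split; first exact: (restrL_pair_connection sQ sP uP unit_flat_diff').
  exact: preserves_leaf Dminus_metric.
move=> X Y sX sY x.
exact: (pair_conn_torsion_free sQ sP flat_skew' unit_flat_diff' x sX sY).
Qed.

(** On the vector of S_+ or S_- above a, the expression a B - alpha is - a g or a g, so the
    generalized metric is twice g on each summand and the two summands are orthogonal. *)
Lemma genmetric_split : genmetric F = split_form flat_plus flat_minus (- 1).
Proof.
apply/funext => x; apply/funext => v; apply/funext => w.
set v1 := graph_proj (flat_plus x) (flat_minus x) v.
set v2 := graph_proj (flat_minus x) (flat_plus x) v.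
set w1 := graph_proj (flat_plus x) (flat_minus x) w.
set w2 := graph_proj (flat_minus x) (flat_plus x) w.
have E a b : (a + b) *m Bf F x - (a *m flat_plus x + b *m flat_minus x) =
    (b - a) *m gf F x.
  rewrite /flat_plus /flat_minus mulmxDr mulmxBr !mulmxDl mulNmx addrACA opprD.
  by rewrite addrA subrr sub0r opprB.
have inv_g (a b : W) : bil (a *m gf F x) (invmx (gf F x)) (b *m gf F x) = bil a (gf F x) b.
  by rewrite /bil mulmxK ?unit_gf // trmx_mul gf_sym mulmxA.
rewrite /genmetric /bilin -!/(bil _ _ _).
rewrite /split_form -/v1 -/v2 -/w1 -/w2 flat_diff flat_diff' !bilZm.
rewrite [in LHS](graph_proj_sum v (unit_flat_diff x)) -/v1 -/v2.
rewrite [in LHS](graph_proj_sum w (unit_flat_diff x)) -/w1 -/w2.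
rewrite !add_row_mx !row_mxKl !row_mxKr !E inv_g !(bilDl, bilDr, bilNl, bilNr).
by ring.
Qed.

Lemma nabla1_double_metric : double_metric_connection F nabla1.
Proof.
split.
- exact: (comb_conn_connection sP sQ uP uQ unit_flat_diff).
- rewrite (gamma_split flat_skew unit_flat_diff).
  exact: (comb_conn_preserves sP sQ flat_skew uP uQ unit_flat_diff).
- rewrite genmetric_split.
  exact: (comb_conn_preserves sP sQ flat_skew uP uQ unit_flat_diff).
Qed.

Lemma comb_connC (A B : M -> 'M[R]_m) : comb_conn A B = comb_conn B A.
Proof.
by apply/funext => Z; apply/funext => Y; apply/funext => x; exact: addrC.
Qed.

Lemma nabla1_torsion : vanishing_mixed_torsion F nabla1.
Proof.
move=> X Y U sX sY sU x; split.
  exact: (comb_conn_torsion sP sQ flat_skew uP uQ unit_flat_diff x sX sY sU).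
rewrite /nabla1 comb_connC.
exact: (comb_conn_torsion sQ sP flat_skew' uQ uP unit_flat_diff' x sX sY sU).
Qed.

Lemma nabla1_restricts : restricts_to_levi_civita F nabla1.
Proof.
exists Dplus, Dminus; split.
- split.
  + by split; [exact: Dplus_connection | exact: Dplus_metric].
  + by split; [exact: Dminus_connection | exact: Dminus_metric].
  + move=> Z X sZ sX x.
    exact: (comb_conn_graph sP sQ uP uQ unit_flat_diff x sZ sX).
- exact: Dplus_levi_civita.
- exact: Dminus_levi_civita.
Qed.

(** Along L the two connections agree by uniqueness of the Levi-Civita connection, and L
    with the graph of B spans the tangent bundle. *)
Lemma pair_unique (B : M -> 'M[R]_m) (D1 D2 : (M -> V) -> (M -> W) -> M -> W) Z Y x :
  smoothLL B -> (forall x, B x \in unitmx) ->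
  is_connection id (@smoothT _ _ M) (@smoothL _ _ M) D1 ->
  is_connection id (@smoothT _ _ M) (@smoothL _ _ M) D2 ->
  levi_civita F (restrL D1) -> levi_civita F (restrL D2) ->
  (forall U, smoothL U -> D1 (graph_sec B U) Y x = D2 (graph_sec B U) Y x) ->
  smoothT Z -> smoothL Y -> D1 Z Y x = D2 Z Y x.
Proof.
move=> sB uB c1 c2 l1 l2 H sZ sY.
have sg := smooth_graph_part sB uB sZ; have sl := smooth_leaf_part sB uB sZ.
have -> : Z = fun y => inL (fun z => leaf_part (B z) (Z z)) y +
    graph_sec B (fun z => graph_part (B z) (Z z)) y.
  by apply/funext => y; exact: leaf_graph_sum.
have sgT := smooth_graph_sec sB sg.
rewrite (connection_addl _ c1 sl sgT sY) (connection_addl _ c2 sl sgT sY).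
rewrite (H _ sg); congr (_ + _).
exact: (levi_civita_unique (unit_gf x) l1 l2 sl sY).
Qed.

(** Vanishing of the mixed torsion gives the values of both connections along the opposite
    graph, paired with arbitrary sections; [pair_unique] does the rest. *)
Lemma nabla1_unique (nabla' : (M -> V) -> (M -> V) -> M -> V) (Z Y : M -> V) :
  double_metric_connection F nabla' -> vanishing_mixed_torsion F nabla' ->
  restricts_to_levi_civita F nabla' -> smoothT Z -> smoothT Y ->
  nabla' Z Y = nabla1 Z Y.
Proof.
move=> [cn _ _] tors [Dp [Dm [[[cDp _] [cDm _] E] lp lm]]] sZ sY.
have gP A : smoothL A -> smoothT (graph_sec flat_plus A) by exact: smooth_graph_sec.
have gQ A : smoothL A -> smoothT (graph_sec flat_minus A) by exact: smooth_graph_sec.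
have Ep Z' A x : smoothT Z' -> smoothL A -> nabla' Z' (graph_sec flat_plus A) x =
    graph_vec (flat_plus x) (Dp Z' A x).
  by move=> sZ' sA; have [] := E Z' A sZ' sA x.
have Em Z' A x : smoothT Z' -> smoothL A -> nabla' Z' (graph_sec flat_minus A) x =
    graph_vec (flat_minus x) (Dm Z' A x).
  by move=> sZ' sA; have [] := E Z' A sZ' sA x.
have Dp_eq A x : smoothL A -> Dp Z A x = Dplus Z A x.
  move=> sA; apply: (pair_unique sQ uQ cDp Dplus_connection lp Dplus_levi_civita) => //.
  move=> U sU; apply: (bil_test_sections (x := x) (unit_flat_diff x)) => C sC.
  have [T0 _] := tors U A C sU sA sC x.
  have := mixed_torsionE flat_skew (Ep _ _ x (gQ _ sU) sA) (Em _ _ x (gP _ sA) sU)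
    (Em _ _ x (gP _ sC) sU) (Ep _ _ x (gP _ sC) sA).
  rewrite [LHS]T0 (gamma_bracket_mixed sP sQ flat_skew uQ unit_flat_diff x (C x) sU sA).
  by move/esym/eqP; rewrite subr_eq0 => /eqP.
have Dm_eq A x : smoothL A -> Dm Z A x = Dminus Z A x.
  move=> sA; apply: (pair_unique sP uP cDm Dminus_connection lm Dminus_levi_civita) => //.
  move=> U sU; apply: (bil_test_sections (x := x) (unit_flat_diff' x)) => C sC.
  have [_ T0] := tors U A C sU sA sC x.
  have := mixed_torsionE flat_skew' (Em _ _ x (gP _ sU) sA) (Ep _ _ x (gQ _ sA) sU)
    (Ep _ _ x (gQ _ sC) sU) (Em _ _ x (gQ _ sC) sA).
  rewrite [LHS]T0 (gamma_bracket_mixed sQ sP flat_skew' uP unit_flat_diff' x (C x) sU sA).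
  by move/esym/eqP; rewrite subr_eq0 => /eqP.
apply/funext => x.
have sp := smooth_proj_sec sP sQ unit_flat_diff sY.
have sm := smooth_proj_sec sQ sP unit_flat_diff' sY.
have YE : Y = fun y => graph_sec flat_plus (proj_sec flat_plus flat_minus Y) y +
    graph_sec flat_minus (proj_sec flat_minus flat_plus Y) y.
  by apply/funext => y; exact: graph_proj_sum (unit_flat_diff y).
have [_ _ addn _] := cn.
rewrite [in LHS]YE (addn Z _ _ sZ (gP _ sp) (gQ _ sm)) (Ep _ _ _ sZ sp) (Em _ _ _ sZ sm).
by rewrite (Dp_eq _ _ sp) (Dm_eq _ _ sm).
Qed.

End FieldConnection.

Theorem proposition5p1 (R : realType) (m : nat) (M : fblManifold R m)
    (p q : nat) (F : gBfield M p q)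
    (flat_iso : forall x : M,
      (Bf F x + gf F x \in unitmx) && (Bf F x - gf F x \in unitmx)) :
  exists nabla : (M -> 'rV[R]_(m + m)) -> (M -> 'rV[R]_(m + m)) -> M -> 'rV[R]_(m + m),
    [/\ double_metric_connection F nabla,
        vanishing_mixed_torsion F nabla,
        restricts_to_levi_civita F nabla
      & forall nabla' :
          (M -> 'rV[R]_(m + m)) -> (M -> 'rV[R]_(m + m)) -> M -> 'rV[R]_(m + m),
        double_metric_connection F nabla' ->
        vanishing_mixed_torsion F nabla' ->
        restricts_to_levi_civita F nabla' ->
        forall X Y, smoothT X -> smoothT Y -> nabla' X Y = nabla X Y].
Proof.
have uP x : flat_plus F x \in unitmx by have /andP[] := flat_iso x.
have uQ x : flat_minus F x \in unitmx by have /andP[] := flat_iso x.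
exists (nabla1 F); split.
- exact: nabla1_double_metric.
- exact: nabla1_torsion.
- exact: nabla1_restricts.
- by move=> nabla' dm vt rl X Y sX sY; exact: nabla1_unique.
Qed.
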